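(* Let $n\in\mathbb{N}^+$. If $K$ is a compact metric space with $\dim_t K\geq n$, then $$\dim_{t^nH}K=\min P_{l^n}=\min P_{w^n}$$ (in particular, these minima exist).
   Context: $\mathbb{N}=\{0,1,2,\dots\}$ and $\mathbb{N}^+=\{1,2,\dots\}$. $\dim_H$ is Hausdorff dimension, with $\dim_H\emptyset=-1$. $\dim_t$ is the small inductive topological dimension: $\dim_t\emptyset=-1$ and, for non-empty $X$, $\dim_t X=\inf\{d: X \text{ has a basis } \mathcal{U} \text{ such that } \dim_t\partial U\leq d-1 \text{ for every } U\in\mathcal{U}\}$. The $n$th inductive topological Hausdorff dimension: $\dim_{t^nH}\emptyset=-1$ for all $n\in\mathbb{N}$, and for non-empty $X$, $\dim_{t^0H}X=\dim_H X$ and, for $n\geq 1$, $\dim_{t^nH}X=\inf\{d: X\text{ has a basis }\mathcal{U}\text{ such that }\dim_{t^{n-1}H}\partial U\leq d-1\text{ for every }U\in\mathcal{U}\}$. All these dimensions may be $\infty$ (so $d=\infty$ is allowed in the infima), with $\infty-c=\infty$ for finite $c$. $C_n(K)$ is the complete metric space of continuous functions $K\to\mathbb{R}^n$ with the supremum norm. A property holds for the generic element of a complete metric space if the set of elements having it is co-meager. A set is somewhere dense if it is dense in some non-empty open set. $P_{l^n}=\{d\geq n:\exists G\subseteq K$ such that $\dim_H G\leq d-n$ and for the generic $f\in C_n(K)$ we have $\#(f^{-1}(y)\setminus G)\leq n$ for all $y\in\mathbb{R}^n\}$. A function $f\in C_n(K)$ is $d$-level narrow if there exists a dense set $S_f\subseteq\mathbb{R}^n$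 such that $\dim_H f^{-1}(y)\leq d-n$ for every $y\in S_f$; $\mathcal{N}_n(d)$ is the set of $d$-level narrow functions, and $P_{w^n}=\{d\geq n:\mathcal{N}_n(d)\text{ is somewhere dense in }C_n(K)\}$. By convention $\infty\in P_{l^n}$ and $\infty\in P_{w^n}$. *)

(* Defs.v *)
From HB Require Import structures.
From mathcomp Require Import all_boot all_order all_algebra.
From mathcomp Require Import all_classical all_reals all_analysis.

Set Implicit Arguments.
Unset Strict Implicit.
Unset Printing Implicit Defensive.

Import Order.TTheory GRing.Theory Num.Theory.
Import numFieldNormedType.Exports.

Local Open Scope classical_set_scope.
Local Open Scope ring_scope.
Local Open Scope ereal_scope.

Definition is_min (R : realType) (A : set (\bar R)) (m : \bar R) : Prop :=
  A m /\ lbound A m.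

Section category.
Context {T : topologicalType}.
Implicit Types A : set T.

Definition boundary A : set T := closure A `\` interior A.

Definition nowhere_dense A : Prop := interior (closure A) = set0.

Definition meager A : Prop :=
  exists2 F : (set T)^nat, (forall i, nowhere_dense (F i)) & A = \bigcup_i F i.

Definition comeager A : Prop := meager (~` A).

Definition somewhere_dense A : Prop :=
  exists O : set T, [/\ open O, O !=set0 & O `<=` closure A].

End category.

(* All dimensions are defined on subsets X of an ambient metric space K, each X
   carrying the restricted metric: [basis] and [boundary] are taken in the type
   [set_type X], whose topology is the subspace topology, and boundaries are
   then viewed again as subsets of K. *)
Section dimensions.
Context {R : realType} {K : metricType R}.
Implicit Types X : set K.

Definition diam (U : set K) : \bar R :=
  ereal_sup [set (mdist p.1 p.2)%:E | p in U `*` U].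

(* (diam U)^s, with the conventions that the empty set contributes 0 and that
   (diam U)^0 = 1 for nonempty U. *)
Definition diam_pow (s : R) (U : set K) : \bar R :=
  if U == set0 then 0 else poweR (diam U) s.

Definition hausdorff_premeasure (s delta : R) X : \bar R :=
  ereal_inf [set \sum_(i <oo) diam_pow s (U i) | U in
    [set U : (set K)^nat | X `<=` \bigcup_i U i /\
                           forall i, diam (U i) <= delta%:E]].

Definition hausdorff_measure (s : R) X : \bar R :=
  ereal_sup [set hausdorff_premeasure s delta X | delta in
    [set delta : R | (0 < delta)%R]].

Definition dimH X : \bar R :=
  if X == set0 then (-1)%:E
  else ereal_inf [set s%:E | s in
         [set s : R | (0 <= s)%R /\ hausdorff_measure s X = 0]].

(* [dimt_lt k X] means dim_t X <= k - 1; the defining recursion of dim_t is on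
   the value of the dimension.  [dimt_recursion] below shows that [dimt]
   satisfies the usual recursive equation. *)
Fixpoint dimt_lt (k : nat) X : Prop :=
  match k with
  | 0%N => X = set0
  | k'.+1 => exists2 B : set (set (set_type X)), basis B &
               forall U, B U -> dimt_lt k' (set_val @` boundary U)
  end.

Definition dimt X : \bar R :=
  ereal_inf [set (k%:R - 1)%:E | k in [set k : nat | dimt_lt k X]].

Fixpoint dimtH (n : nat) X : \bar R :=
  if X == set0 then (-1)%:E else
  match n with
  | 0%N => dimH X
  | n'.+1 => ereal_inf [set d : \bar R |
      exists2 B : set (set (set_type X)), basis B &
        forall U, B U -> dimtH n' (set_val @` boundary U) <= d - 1]
  end.

End dimensions.

Section dimt_theory.
Context {R : realType} {K : metricType R}.
Implicit Types X : set K.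

Lemma dimt_ltW (j k : nat) X : (j <= k)%N -> dimt_lt j X -> dimt_lt k X.
Proof.
have empty_lt i (Y : set K) : Y = set0 -> dimt_lt i Y.
  move=> Y0; have nY (x : set_type Y) : False.
    have Yx : Y (set_val x) by exact: set_valP.
    by have : (set0 : set K) (set_val x) by apply: (eq_ind Y (fun Z => Z _) Yx).
  elim: i => [//|i IH] /=; exists open.
    by split=> // x; case: (nY x).
  move=> U _; suff -> : set_val @` boundary U = Y by [].
  by apply: (etrans _ (esym Y0)); apply/seteqP; split=> [y [x]|//]; have := nY x.
elim: j k X => [|j IH] [|k] X //; first by move=> _; exact: empty_lt.
move=> jk Xj; case: Xj => B bB BU; exists B => // U BU1; exact: IH jk (BU _ BU1).
Qed.

Lemma dimt_ltE (k : nat) X : dimt_lt k X <-> dimt X <= (k%:R - 1)%:E.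
Proof.
split=> [Xk|]; first by apply: ereal_inf_lbound; exists k.
move=> Xk; have /ereal_inf_lt[_ [j Xj <-]] : dimt X < k%:R%:E.
  by apply: le_lt_trans Xk _; rewrite lte_fin ltrBlDr ltrDl ltr01.
rewrite lte_fin ltrBlDr natr1 ltr_nat ltnS => jk; exact: dimt_ltW jk Xj.
Qed.

Lemma dimt_geN1 X : (-1)%:E <= dimt X.
Proof.
by apply: le_ereal_inf_tmp => _ [k _ <-]; rewrite lee_fin lerBrDl subrr.
Qed.

Lemma dimt_set0 : dimt (set0 : set K) = (-1)%:E.
Proof.
apply/eqP; rewrite eq_le dimt_geN1 andbT.
by have /dimt_ltE : dimt_lt 0 (set0 : set K) by []; rewrite sub0r.
Qed.

Lemma dimt_recursion X : X !=set0 ->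
  dimt X = ereal_inf [set d : \bar R |
    exists2 B : set (set (set_type X)), basis B &
      forall U, B U -> dimt (set_val @` boundary U) <= d - 1].
Proof.
move=> [x0 Xx0]; apply/eqP; rewrite eq_le; apply/andP; split.
  apply: le_ereal_inf_tmp => d [B bB BU].
  have d0 : 0 <= d.
    have [|U [BU' _] _] := bB.2 (SigSub (mem_set Xx0)) setT; first exact: filterT.
    have := le_trans (dimt_geN1 _) (BU _ BU').
    by case: d {BU} => //= r; rewrite !lee_fin lerBrDl subrr.
  case: d d0 BU => [r| |]; [|by move=> _ _; rewrite leey|by []].
  rewrite lee_fin => r0 BU; set k := Num.truncn r.
  have /andP[kr rk] : (k%:R <= r < k.+1%:R)%R by exact: truncn_itv.
  apply: (@le_trans _ _ (k.+1%:R - 1)%:E); last first.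
    by rewrite lee_fin -natr1 addrK.
  apply/dimt_ltE; exists B => // U BU1; have H := BU _ BU1.
  have /ereal_inf_lt[_ [j Uj <-]] :
      dimt (set_val @` boundary U) < k%:R%:E.
    by apply: le_lt_trans H _; rewrite lte_fin ltrBlDr natr1.
  rewrite lte_fin ltrBlDr natr1 ltr_nat ltnS => jk; exact: dimt_ltW jk Uj.
apply: le_ereal_inf_tmp => _ [[|k] Xk <-]; first by move: Xx0; move: Xk => /= ->.
apply: ereal_inf_lbound => /=; case: Xk => B bB BU; exists B => // U BU1.
by have /dimt_ltE := BU _ BU1; rewrite -EFinB -natr1 addrK.
Qed.

End dimt_theory.

(* C_n(K) for compact K: continuous functions with the topology of uniform
   convergence (see [nbhs_contfunP]).  'rV[R]_n carries the max norm; the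
   Euclidean norm is equivalent to it and so gives the same topology on R^n and
   on C_n(K), which is all that the notions below depend on. *)
Section contfun.
Context {R : realType}.

Definition contfun (n : nat) (K : metricType R) : Type :=
  initial_topology
    (id : continuousType K 'rV[R]_n -> {uniform K -> 'rV[R]_n}).

HB.instance Definition _ n K := Uniform.copy (contfun n K)
  (initial_topology
    (id : continuousType K 'rV[R]_n -> {uniform K -> 'rV[R]_n})).

Definition contfun_fun n K (f : contfun n K) : K -> 'rV[R]_n :=
  (f : continuousType K 'rV[R]_n).

End contfun.
Coercion contfun_fun : contfun >-> Funclass.

Lemma nbhs_contfunP (R : realType) (n : nat) (K : metricType R)
    (f : contfun n K) (A : set (contfun n K)) :
  nbhs f A <-> exists2 e : R, (0 < e)%R &
    forall g : contfun n K, (forall x, `|f x - g x| < e)%R -> A g.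
Proof.
split.
  move=> [_ [[W oW <-]] /= Wf WA].
  have : nbhs (f : {uniform K -> 'rV[R]_n}) W by exact: open_nbhs_nbhs.
  move=> /uniform_nbhs[E [entE EW]].
  move: entE; rewrite -entourage_ballE => -[e /= e0 eE].
  exists e => // g fg; apply: WA; apply: EW => x _; apply: eE.
  by rewrite /= -ball_normE; exact: fg.
move=> [e e0 H].
have : nbhs (f : {uniform K -> 'rV[R]_n})
    [set g | forall x, [set: K] x -> ball (f x) e (g x)].
  apply/uniform_nbhs; exists [set xy | ball xy.1 e xy.2]; split => //.
  by rewrite -entourage_ballE; exists e.
move=> fe; have := @initial_continuous (continuousType K 'rV[R]_n)
  {uniform K -> 'rV[R]_n} id f _ fe => fe1.
apply: (@filterS _ (nbhs f) _ _ _ _ fe1) => g /= fg; apply: H => x.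
by have := fg x I; rewrite -ball_normE.
Qed.

Section level_sets.
Context {R : realType}.
Implicit Types (n : nat) (K : metricType R) (d : \bar R).

Definition P_l n K : set (\bar R) := [set d | d = +oo \/
  (n%:R%:E <= d /\ exists2 G : set K, dimH G <= d - n%:R%:E &
     comeager [set f : contfun n K |
       forall y : 'rV[R]_n, ((f @^-1` [set y]) `\` G #<= `I_n)%card])].

Definition level_narrow n K d : set (contfun n K) := [set f |
  exists2 S : set 'rV[R]_n, dense S &
    forall y, S y -> dimH (f @^-1` [set y]) <= d - n%:R%:E].

Definition P_w n K : set (\bar R) := [set d | d = +oo \/
  (n%:R%:E <= d /\ somewhere_dense (@level_narrow n K d))].

End level_sets.

(* Main.v *)
Require Import Defs.
From mathcomp Require Import all_boot all_order all_algebra finmap.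
From mathcomp Require Import all_classical all_reals all_analysis.
From mathcomp Require Import ring lra zify.

(** Everything goes through the following property of a compact set [X], called
    [thin n s X] below: at every scale [e], [X] is covered by [n] families, each
    made of finitely many separated pieces of diameter at most [e], and an open
    set with a cover of total [s]-dimensional size at most [e].

    - If [dimtH n X < s + n], then [X] is thin: induct on [n], cover [X] by
      finitely many small open sets, apply the induction hypothesis to their
      boundaries, and sort the points off a neighbourhood of the boundaries into
      one more family of small pieces.
    - Conversely a thin [X] has [dimtH n X <= s + n]: a point and a closed set
      are separated by letting two sets grow, absorbing at every scale the pieces
      of the last family; what is left over is thin with [n - 1] families.
    - If [K] is thin for every [s > t], let [G] be the limit superior of the open
      remainders, so that [dimH G <= t].  Moving the [i]-th coordinate of a map
      so that it separates the pieces of the [i]-th family (as in Kolmogorov's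
      superposition theorem), a generic map has at most one point of a fiber off
      [G] per family.
    - If level narrow maps are dense near [f0], start with a fine open cover and
      shrink it, for every [n + 1] members, along a level of a narrow map close to
      [f0] plus bumps supported in [n] of these members, so that the [n + 1]
      members only meet in a small set.  A cover of order [n] yields [n] families
      by looking at the gaps between the values of the distances to the
      complements of its members.

    Finally [P_l] is contained in [P_w] by the Baire category theorem. *)

Set Implicit Arguments.
Unset Strict Implicit.
Unset Printing Implicit Defensive.

Import Order.TTheory GRing.Theory Num.Theory.
Import numFieldNormedType.Exports.

Local Open Scope classical_set_scope.
Local Open Scope ring_scope.

(** * Finite minima and compactness *)

Lemma natSinv_le (R : archiRealFieldType) (e : R) : 0 < e ->
  exists k, k.+1%:R^-1 <= e.
Proof.
move=> e0; exists (Num.truncn e^-1); rewrite -[leRHS]invrK lef_pV2 ?posrE ?invr_gt0//.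
by apply: ltW; exact: truncnS_gt.
Qed.

Lemma fin_common_radius (R : realFieldType) (T : finType) (P : T -> R -> Prop) :
  (forall t w w', 0 < w' -> w' <= w -> P t w -> P t w') ->
  (forall t, exists2 w, 0 < w & P t w) -> exists2 w, 0 < w & forall t, P t w.
Proof.
move=> Pmono Pex.
have /choice[w wP] : forall t, exists w, 0 < w /\ P t w.
  by move=> t; have [w] := Pex t; exists w.
have w0 : 0 < \big[Num.min/1]_t w t.
  by rewrite lt_bigmin // => t _; have [] := wP t.
exists (\big[Num.min/1]_t w t) => // t; apply: (Pmono _ (w t)) => //.
  exact: bigmin_le.
by have [] := wP t.
Qed.

Lemma compact_finite_cover (T : topologicalType) (I : choiceType)
    (V : I -> set T) (Z : set T) : compact Z -> (forall i, open (V i)) ->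
  Z `<=` \bigcup_i V i -> exists D : {fset I}, Z `<=` \bigcup_(i in [set` D]) V i.
Proof.
move=> /compact_near_coveringP cZ oV ZV.
(* [F] is the filter of all sufficiently large finite index sets. *)
pose F := filter_from setT (fun D0 : {fset I} => [set D | (D0 `<=` D)%fset]).
have FF : Filter F.
  apply: filter_from_filter; first by exists fset0.
  move=> D E _ _; exists (D `|` E)%fset => // G /= DEG.
  by split; apply: fsubset_trans DEG; rewrite ?fsubsetUl ?fsubsetUr.
have [|D _ DZ] := cZ _ F (fun D => \bigcup_(i in [set` D]) V i) FF.
  move=> x /ZV[i _ Vix]; exists (V i, [set D | ([fset i] `<=` D)%fset]).
    split; first by apply: open_nbhs_nbhs; split=> //; exact: oV.
    by exists [fset i]%fset.
  by move=> [y D] /= [Viy]; rewrite fsub1set => iD; exists i.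
by exists D; apply: DZ => //=; exact: fsubset_refl.
Qed.

(** * Neighbourhoods and truncated distances in a metric space *)

Section metric.
Context {R : realType} {K : metricType R}.
Implicit Types (A U X Z : set K) (x y z : K).

Lemma nbhs_mdist_lt x A :
  nbhs x A <-> exists2 r : R, 0 < r & forall y, mdist x y < r -> A y.
Proof.
rewrite -metricType_numDomainType.filter_from_mdist_nbhs.
by split=> -[r r0 rA]; exists r => // y; exact: rA.
Qed.

Lemma open_mdistP U :
  open U <-> forall x, U x -> exists2 r : R, 0 < r & forall y, mdist x y < r -> U y.
Proof.
rewrite openE; split=> UP x /UP; first by move=> /nbhs_mdist_lt.
by move=> ?; apply/nbhs_mdist_lt.
Qed.

Definition thicken (e : R) A := [set x | exists2 a, A a & mdist a x < e].

Lemma thicken_open e A : open (thicken e A).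
Proof.
apply/open_mdistP => x [a Aa ax]; exists (e - mdist a x); first by rewrite subr_gt0.
move=> y; rewrite ltrBrDl => xy; exists a => //.
exact: le_lt_trans (metric_triangle _ x _) xy.
Qed.

Lemma sub_thicken e A : 0 < e -> A `<=` thicken e A.
Proof. by move=> e0 x Ax; exists x; rewrite ?mdistxx. Qed.

Lemma lebesgue_number I (U : I -> set K) Z : compact Z ->
  (forall x, Z x -> exists i, nbhs x (U i)) ->
  exists2 r : R, 0 < r & forall x, Z x -> exists i, forall y, mdist x y < r -> U i y.
Proof.
move=> /compact_near_coveringP cZ ZU.
pose P (r : R) x := exists i, forall y, mdist x y < r -> U i y.
have := cZ R (0^'+) P _; case.
  move=> x /ZU[i] /nbhs_mdist_lt[r r0 rU].
  exists ([set y | mdist x y < r / 2], [set e | 0 < e < r / 2]) => /=.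
    split; last by near=> e; apply/andP; split; near: e;
      [exact: nbhs_right_gt|apply: nbhs_right_lt; rewrite divr_gt0].
    by apply/nbhs_mdist_lt; exists (r / 2); rewrite ?divr_gt0.
  move=> [x' e] /= [xx' /andP[e0 er]]; exists i => y x'y; apply: rU.
  by rewrite (le_lt_trans (metric_triangle _ x' _))// (splitr r) ltrD// (lt_trans x'y).
move=> r /= r0 rP.
exists (r / 2); first by rewrite divr_gt0.
move=> x Zx; apply: (rP (r / 2)) => //=.
  by rewrite sub0r normrN ger0_norm ?divr_ge0 ?ltW// gtr_pMr// invf_lt1 ?ltr1n.
by rewrite divr_gt0.
Unshelve. all: by end_near. Qed.

(** Distance to [A] cut off at [c]; the cap also handles empty [A], where the value is [c]. *)
Definition capdist (c : R) A x : R := inf ([set c] `|` [set mdist x a | a in A]).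

Section capdist.
Variables (c : R) (A : set K).
Hypothesis c0 : 0 <= c.

Let has_inf_cap x : has_inf ([set c] `|` [set mdist x a | a in A]).
Proof.
split; first by exists c; left.
by exists 0 => _ [->//|[a _ <-]]; exact: mdist_ge0.
Qed.

Lemma capdist_ge0 x : 0 <= capdist c A x.
Proof.
apply: lb_le_inf; first by exists c; left.
by move=> _ [->//|[a _ <-]]; exact: mdist_ge0.
Qed.

Lemma capdist_le_cap x : capdist c A x <= c.
Proof. by apply: ge_inf; [have [] := has_inf_cap x|left]. Qed.

Lemma capdist_le x a : A a -> capdist c A x <= mdist x a.
Proof. by move=> Aa; apply: ge_inf; [have [] := has_inf_cap x|right; exists a]. Qed.

Lemma capdist_lb x r : r <= c -> (forall a, A a -> r <= mdist x a) ->
  r <= capdist c A x.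
Proof.
move=> rc rA; apply: lb_le_inf; first by exists c; left.
by move=> _ [->//|[a Aa <-]]; exact: rA.
Qed.

Lemma capdist0 x : A x -> capdist c A x = 0.
Proof.
move=> Ax; apply/eqP; rewrite eq_le capdist_ge0 andbT.
by rewrite -(mdistxx x); exact: capdist_le.
Qed.

Lemma capdistT x : (forall a, A a -> c <= mdist x a) -> capdist c A x = c.
Proof. by move=> xA; apply/eqP; rewrite eq_le capdist_le_cap capdist_lb. Qed.

Lemma capdist_lip x y : `|capdist c A x - capdist c A y| <= mdist x y.
Proof.
wlog suff H : x y / capdist c A x - capdist c A y <= mdist x y.
  by rewrite ler_norml H lerNl opprB metric_sym H.
rewrite lerBlDr -lerBlDl; apply: capdist_lb.
  by rewrite lerBlDl (le_trans (capdist_le_cap x))// lerDr mdist_ge0.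
move=> a Aa; rewrite lerBlDl (le_trans (capdist_le x Aa))//.
exact: metric_triangle.
Qed.

Lemma capdist_continuous : continuous (capdist c A).
Proof.
move=> x; apply/cvgrPdist_lt => e e0; apply/nbhs_mdist_lt; exists e => // y xy.
exact: le_lt_trans (capdist_lip x y) xy.
Qed.

End capdist.

End metric.

(** * Hausdorff measure through open covers *)

Section hausdorff.
Context {R : realType} {K : metricType R}.
Implicit Types (U V X Y : set K).
Local Open Scope ereal_scope.

Lemma diam_leP U (r : R) : diam U <= r%:E <->
  forall x y, U x -> U y -> (mdist x y <= r)%R.
Proof.
split=> [Ur x y Ux Uy|Ur]; last first.
  by apply: ge_ereal_sup => _ [[x y] [/= Ux Uy] <-]; rewrite lee_fin Ur.
by rewrite -lee_fin; apply: le_trans Ur; apply: ereal_sup_ubound; exists (x, y).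
Qed.

Lemma diam_ge0 U : U !=set0 -> 0 <= diam U.
Proof.
by move=> [x Ux]; apply: ereal_sup_ubound; exists (x, x); rewrite //= mdistxx.
Qed.

Lemma diam_pow_ge0 s U : 0 <= diam_pow s U.
Proof. by rewrite /diam_pow; case: ifPn => // _; exact: poweR_ge0. Qed.

Lemma diam_pow_fin s U (r : R) : U !=set0 -> diam U = r%:E ->
  diam_pow s U = (r `^ s)%:E.
Proof. by move=> /set0P/negPf U0 Ur; rewrite /diam_pow U0 Ur poweR_EFin. Qed.

Lemma diam_pow_set0 s : diam_pow s (set0 : set K) = 0.
Proof. by rewrite /diam_pow eqxx. Qed.

Lemma diam_pow_ler s s' U : (0 <= s)%R -> (s <= s')%R -> diam U <= 1 ->
  diam_pow s' U <= diam_pow s U.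
Proof.
move=> s0 ss' U1; have [->|/set0P U0] := eqVneq U set0; first by rewrite !diam_pow_set0.
have := diam_ge0 U0; case Ur : (diam U) U1 => [r| |]// r1 r0.
rewrite !(diam_pow_fin _ U0 Ur) lee_fin.
move: r1 r0; rewrite !lee_fin => r1; rewrite le_eqVlt => /predU1P[<-|r0].
  by rewrite /powR eqxx ler_nat; do 2 case: eqP => //=; lra.
by apply: ger_powR => //; rewrite r0.
Qed.

Lemma diam_pow_open_ext s U (e : R) : (0 < s)%R -> (0 < e)%R ->
  exists V, [/\ open V, U `<=` V & diam_pow s V <= diam_pow s U + e%:E].
Proof.
move=> s0 e0; have [->|/set0P U0] := eqVneq U set0.
  by exists set0; split=> //; [exact: open0|rewrite diam_pow_set0 add0e lee_fin ltW].
have [Uy|Uy] := eqVneq (diam U) +oo.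
  exists setT; split=> //; first exact: openT.
  by have /set0P/negPf nU0 := U0; rewrite {2}/diam_pow nU0 Uy poweRyr ?gt_eqF// addye// leey.
have := diam_ge0 U0; case Ur : (diam U) Uy => [r| |]// _; rewrite lee_fin => r0.
(* The diameter whose [s]-th power exceeds that of [r] by exactly [e]; thickening [U] by
   [(b - r) / 2] stays within it. *)
pose b := ((r `^ s + e) `^ s^-1)%R.
have bs : (b `^ s = r `^ s + e)%R.
  by rewrite -powRrM mulVf ?gt_eqF// powRr1// addr_ge0 ?powR_ge0 ?ltW.
have rb : (r < b)%R.
  rewrite ltNge; apply/negP => br.
  have := @ge0_ler_powR _ s (ltW s0) b r; rewrite !nnegrE powR_ge0 => /(_ isT r0 br).
  by rewrite bs -[leRHS]addr0 lerD2l leNgt e0.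
exists (thicken ((b - r) / 2) U); split; first exact: thicken_open.
  by apply: sub_thicken; rewrite divr_gt0 ?subr_gt0.
have Vb : diam (thicken ((b - r) / 2) U) <= b%:E.
  apply/diam_leP => x y [x' Ux' xx'] [y' Uy' yy'].
  have /diam_leP/(_ x' y' Ux' Uy') : diam U <= r%:E by rewrite Ur.
  have := metric_triangle x x' y; have := metric_triangle x' y' y.
  rewrite (metric_sym x x'); lra.
have V0 : thicken ((b - r) / 2) U !=set0.
  by case: U0 => x Ux; exists x; apply: sub_thicken => //; rewrite divr_gt0 ?subr_gt0.
have := diam_ge0 V0; move: Vb; case Vr : (diam (thicken _ _)) => [v| |] //.
rewrite !lee_fin => vb v0.
rewrite (diam_pow_fin _ V0 Vr) (diam_pow_fin _ U0 Ur) -EFinD -bs lee_fin.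
by apply: ge0_ler_powR => //; [exact: ltW|rewrite nnegrE powR_ge0].
Qed.

(** No bound on the diameters is imposed: for [s > 0] the bound on the sum already limits each of
    them, so such covers for every [e] force [s]-dimensional measure zero. *)
Definition small_cover (s e : R) X := exists U : (set K)^nat,
  [/\ forall k, open (U k), X `<=` \bigcup_k U k &
      \sum_(k <oo) diam_pow s (U k) <= e%:E].

Lemma small_cover_sub s e e' X Y : (e <= e')%R -> Y `<=` X ->
  small_cover s e X -> small_cover s e' Y.
Proof.
move=> ee' YX [U [oU XU Ue]]; exists U; split=> //; first exact: subset_trans XU.
by apply: le_trans Ue _; rewrite lee_fin.
Qed.

Lemma small_cover_set0 s (e : R) : (0 <= e)%R -> small_cover s e set0.
Proof.
move=> e0; exists (fun=> set0); split=> // [_|]; first exact: open0.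
by rewrite eseries0 ?lee_fin// => *; rewrite diam_pow_set0.
Qed.

Lemma small_cover_open s e X : small_cover s e X ->
  exists O, [/\ open O, X `<=` O & small_cover s e O].
Proof.
move=> [U [oU XU Ue]]; exists (\bigcup_k U k); split=> //; last by exists U; split.
by apply: bigcup_open => k _; exact: oU.
Qed.

Lemma small_cover_diam_pow s e (U : (set K)^nat) k :
  \sum_(k <oo) diam_pow s (U k) <= e%:E -> diam_pow s (U k) <= e%:E.
Proof.
apply: le_trans; apply: le_trans (nneseries_lim_ge k.+1 _); last first.
  by move=> *; exact: diam_pow_ge0.
by rewrite big_nat_recr//= leeDr// sume_ge0// => i _; exact: diam_pow_ge0.
Qed.

Lemma diam_le_of_pow s U (r : R) : (0 < s)%R -> (0 <= r)%R ->
  diam_pow s U <= (r `^ s)%:E -> diam U <= r%:E.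
Proof.
move=> s0 r0; have [->|/set0P U0] := eqVneq U set0.
  by move=> _; apply/diam_leP.
case Uq: (diam U) => [q| |] H; last by rewrite leNye.
  move: H; rewrite (diam_pow_fin _ U0 Uq) !lee_fin => H.
  rewrite leNgt; apply/negP => rq.
  have := @gt0_ltr_powR _ s s0 r q; rewrite !nnegrE r0 (le_trans r0 (ltW rq)).
  by move=> /(_ isT isT rq); rewrite ltNge H.
by move: H; have /set0P/negPf nU0 := U0; rewrite /diam_pow nU0 Uq poweRyr ?gt_eqF.
Qed.

(** A total of at most 1 forces every diameter to be at most 1, and then a larger exponent only
    lowers each term. *)
Lemma small_cover_exp s s' e X : (0 < s)%R -> (s <= s')%R -> (e <= 1)%R ->
  small_cover s e X -> small_cover s' e X.
Proof.
move=> s0 ss' e1 [U [oU XU Ue]]; exists U; split=> //; apply: le_trans (Ue).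
apply: lee_nneseries => k _; first by move=> _; exact: diam_pow_ge0.
apply: diam_pow_ler => //; first exact: ltW.
apply: diam_le_of_pow s0 _ _ => //.
rewrite powR1; apply: le_trans (_ : e%:E <= _); last by rewrite lee_fin.
exact: small_cover_diam_pow Ue.
Qed.

Lemma small_cover_bigcup s (e : R) (X : (set K)^nat) : (0 <= e)%R ->
  (forall k, small_cover s (e / (2 ^ k.+1)%:R) (X k)) ->
  small_cover s e (\bigcup_k X k).
Proof.
move=> e0 /choice[U UP].
(* A bijection of [nat] with pairs merges the covers into one; the weights [e / 2 ^ k.+1] sum to at
   most [e]. *)
have /card_esym/ppcard_eqP[f] := card_nat2.
exists (fun i => U (f i).1 (f i).2); split.
- by move=> i; have [] := UP (f i).1.
- move=> x [i _ Xix]; have [_ /(_ _ Xix)[j _ Uij] _] := UP i.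
  by exists (f^-1%FUN (i, j)) => //=; rewrite invK ?inE.
rewrite nneseries_esumT; last by move=> *; exact: diam_pow_ge0.
rewrite -(@reindex_esum _ _ _ setT setT f
   (fun p => diam_pow s (U p.1 p.2))); last by rewrite setTT_bijective; exact: bijTT.
have -> : [set: nat * nat] = [set: nat] `*`` (fun=> [set: nat]).
  by apply/seteqP; split.
rewrite -(@esum_esum _ _ _ setT (fun=> setT) (fun i j => diam_pow s (U i j)));
  last by move=> *; exact: diam_pow_ge0.
rewrite -nneseries_esumT; last by move=> *; apply: esum_ge0 => *; exact: diam_pow_ge0.
have := @epsilon_trick R (fun=> 0) e xpredT (fun=> lexx _) e0.
rewrite [X in _ <= X + _]eseries0// add0e; apply: le_trans.
apply: lee_nneseries => i _.
  by move=> _; apply: esum_ge0 => *; exact: diam_pow_ge0.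
rewrite add0e; have [_ _] := UP i; rewrite nneseries_esumT// => *; exact: diam_pow_ge0.
Qed.

Lemma small_cover_setU s (e : R) X Y : (0 <= e)%R ->
  small_cover s (e / 4) X -> small_cover s (e / 4) Y -> small_cover s e (X `|` Y).
Proof.
move=> e0 sX sY.
pose Z k := if k == 0%N then X else if k == 1%N then Y else set0.
have -> : X `|` Y = \bigcup_k Z k.
  apply/seteqP; split=> [x [Xx|Yx]|x [[|[|k]]]]; rewrite ?/Z//=; last 2 first.
  - by left.
  - by right.
  - by exists 0%N.
  - by exists 1%N.
apply: small_cover_bigcup => // -[|[|k]] /=.
- apply: small_cover_sub sX => //; rewrite expn1 ler_wpM2l// lef_pV2 ?posrE//.
  by rewrite ler_nat.
- exact: sY.
by apply: small_cover_set0; rewrite divr_ge0.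
Qed.

(** A cover by sets of diameter at most 1 may be used with the larger exponent [s']; as [s'] is
    positive, its members can be enlarged to open sets at a total cost of [e / 2]. *)
Lemma hausdorff_small_cover s s' e X : (0 <= s)%R -> (s < s')%R -> (0 < e)%R ->
  hausdorff_measure s X = 0 -> small_cover s' e X.
Proof.
move=> s0 ss' e0 X0; have s'0 := le_lt_trans s0 ss'.
have : hausdorff_premeasure s 1 X < (e / 2)%:E.
  apply: (@le_lt_trans _ _ 0); last by rewrite lte_fin divr_gt0.
  by rewrite -X0; apply: ereal_sup_ubound; exists 1%R => //=; exact: ltr01.
move=> /ereal_inf_lt[_ [U [XU U1] <-] Ue].
have /choice[V VP] : forall k, exists V, [/\ open V, U k `<=` V &
    diam_pow s' V <= diam_pow s' (U k) + (e / 2 / (2 ^ k.+1)%:R)%:E].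
  by move=> k; apply: diam_pow_open_ext; rewrite ?divr_gt0// ltr0n expn_gt0.
exists V; split=> [k||]; first by have [] := VP k.
  by move=> x /XU[k _ Ukx]; exists k => //; have [_ + _] := VP k; exact.
apply: (@le_trans _ _ (\sum_(k <oo)
    (diam_pow s' (U k) + (e / 2 / (2 ^ k.+1)%:R)%:E))).
  apply: lee_nneseries => k _; first by move=> _; exact: diam_pow_ge0.
  by have [] := VP k.
apply: le_trans (epsilon_trick _ _ _) _.
- by move=> k; exact: diam_pow_ge0.
- by rewrite divr_ge0// ltW.
rewrite [in leRHS](splitr e) EFinD leeD2r// (le_trans _ (ltW Ue))//.
apply: lee_nneseries => k _; first by move=> _; exact: diam_pow_ge0.
by apply: diam_pow_ler => //; exact: ltW.
Qed.

Lemma small_cover_hausdorff s X : (0 < s)%R ->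
  (forall e, (0 < e)%R -> small_cover s e X) -> hausdorff_measure s X = 0.
Proof.
move=> s0 sX; apply/eqP; rewrite eq_le; apply/andP; split; last first.
  apply: (@le_trans _ _ (hausdorff_premeasure s 1 X)); last first.
    by apply: ereal_sup_ubound; exists 1%R => //=; exact: ltr01.
  apply: le_ereal_inf_tmp => _ [U _ <-]; apply: nneseries_ge0 => *.
  exact: diam_pow_ge0.
apply: ge_ereal_sup => _ [d /= d0 <-]; apply/lee_addgt0Pr => e e0; rewrite add0e.
(* The bound [d ^ s] on the total keeps each diameter at most [d]. *)
have [U [oU XU Ue]] : small_cover s (Num.min e (d `^ s))%R X.
  by apply: sX; rewrite lt_min e0 powR_gt0.
apply: (@le_trans _ _ (\sum_(k <oo) diam_pow s (U k))); last first.
  by apply: le_trans Ue _; rewrite lee_fin ge_min lexx.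
apply: ereal_inf_lbound; exists U => //; split=> // k.
apply: (diam_le_of_pow s0 (ltW d0)).
by apply: le_trans (small_cover_diam_pow k Ue) _; rewrite lee_fin ge_min lexx orbT.
Qed.

Lemma dimH_ge0 X : X !=set0 -> 0 <= dimH X.
Proof.
move=> /set0P/negPf X0; rewrite /dimH X0.
by apply: le_ereal_inf_tmp => _ [s [s0 _] <-].
Qed.

Lemma dimH_lt_small_cover s e X : (0 < s)%R -> (0 < e)%R ->
  dimH X < s%:E -> small_cover s e X.
Proof.
move=> s0 e0; rewrite /dimH; case: ifPn => [/eqP -> _|_].
  by apply: small_cover_set0; exact: ltW.
move=> /ereal_inf_lt[_ [t [t0 Xt] <-]]; rewrite lte_fin => ts.
exact: hausdorff_small_cover Xt.
Qed.

Lemma small_cover_dimH (t : R) X : (0 <= t)%R ->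
  (forall s e, (t < s)%R -> (0 < e)%R -> small_cover s e X) -> dimH X <= t%:E.
Proof.
move=> t0 sX; rewrite /dimH; case: ifPn => _; first by rewrite lee_fin; lra.
apply/lee_addgt0Pr => e e0; apply: ereal_inf_lbound; exists (t + e)%R => //.
split; first by lra.
by apply: small_cover_hausdorff => [|e' e'0]; [lra|apply: sX => //; lra].
Qed.

End hausdorff.

(** * Thin sets *)

Section thin.
Context {R : realType} {K : metricType R}.
Implicit Types (A B O X Y : set K).

(** The pieces are the fibers of [l] on [A]: each has diameter at most [e], and distinct ones are at
    least [h] apart. Labels make the pieces disjoint by construction. *)
Definition fragmented (h e : R) A := exists (T : finType) (l : K -> T),
  forall x y, A x -> A y ->
    (l x = l y -> mdist x y <= e) /\ (mdist x y < h -> l x = l y).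

Lemma fragmented_sub h h' e e' A B : h' <= h -> e <= e' -> B `<=` A ->
  fragmented h e A -> fragmented h' e' B.
Proof.
move=> hh ee BA [T [l lA]]; exists T, l => x y /BA Ax /BA Ay.
have [le lh] := lA _ _ Ax Ay; split=> [/le xy|xy]; first exact: le_trans xy ee.
by apply: lh; exact: lt_le_trans xy hh.
Qed.

(** Each point inherits the label of a chosen point of [A] within [h / 4]; two such displacements
    cost [h / 2] in the gap and in the diameter. *)
Lemma fragmented_thicken h e A : 0 < h -> fragmented h e A ->
  fragmented (h / 2) (e + h / 2) (thicken (h / 4) A).
Proof.
move=> h0 [T [l lA]].
have /choice[p pP] : forall x, exists a,
    thicken (h / 4) A x -> A a /\ mdist a x < h / 4.
  move=> x; have [[a Aa ax]|nx] := pselect (thicken (h / 4) A x).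
    by exists a.
  by exists x.
exists T, (l \o p) => x y /pP[Apx px] /pP[Apy py] /=.
have [le lh] := lA _ _ Apx Apy.
have := metric_triangle x (p x) y; have := metric_triangle (p x) (p y) y.
have := metric_triangle (p x) x (p y); have := metric_triangle x y (p y).
rewrite (metric_sym x (p x)) (metric_sym y (p y)) => *.
split=> [/le ?|xy]; first by lra.
by apply: lh; lra.
Qed.

(* The [B]-fragments are much smaller than the gaps between the [A]-fragments,
   so each of them can be glued to the only [A]-fragment it comes close to. *)
Lemma fragmented_setU h e th r A B : 0 < h -> 0 <= e -> 4 * r <= h ->
  fragmented h e A -> fragmented th r B ->
  fragmented (Num.min (h / 4) th) (e + h) (A `|` B).
Proof.
move=> h0 e0 rh [T [l lA]] [S [m mB]].
pose att x y := A y /\ exists x', [/\ B x', m x' = m x & mdist x' y < h / 4].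
(* A [B]-fragment attaches to at most one [A]-fragment: two points of [A] close to it are less than
   [h / 4 + r + h / 4 < h] apart. *)
have attP x y x' y' : B x -> B x' -> m x = m x' -> att x y -> att x' y' ->
    l y = l y'.
  move=> Bx Bx' mxx' [Ay [z [Bz zx zy]]] [Ay' [z' [Bz' zx' zy']]].
  apply: (lA _ _ Ay Ay').2.
  have : mdist z z' <= r by apply: (mB _ _ Bz Bz').1; rewrite zx zx'.
  have := metric_triangle y z y'; have := metric_triangle z z' y'.
  by rewrite (metric_sym y z) => *; lra.
have attE x x' y : m x = m x' -> att x y -> att x' y.
  by move=> mxx' [Ay [z [Bz zx zy]]]; split=> //; exists z; split; rewrite // zx.
have /choice[f fP] : forall x, exists t : T + S,
    (A x -> t = inl (l x)) /\ (~ A x -> B x ->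
      (exists2 y, att x y & t = inl (l y)) \/
      ((forall y, ~ att x y) /\ t = inr (m x))).
  move=> x; have [Ax|nAx] := pselect (A x); first by exists (inl (l x)).
  have [[y xy]|nx] := pselect (exists y, att x y).
    by exists (inl (l y)); split=> // _ _; left; exists y.
  by exists (inr (m x)); split=> // _ _; right; split=> // y xy; apply: nx; exists y.
exists (T + S)%type, f.
have hinl x : (A `|` B) x -> (A x /\ f x = inl (l x)) \/
    (~ A x /\ B x /\ ((exists2 y, att x y & f x = inl (l y)) \/
      ((forall y, ~ att x y) /\ f x = inr (m x)))).
  have [fA fB] := fP x; have [Ax _|nAx [//|Bx]] := pselect (A x).
    by left; split=> //; exact: fA.
  by right; split=> //; split=> //; exact: fB.
have near x y : B x -> att x y -> mdist x y < h / 2.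
  move=> Bx [Ay [z [Bz zx zy]]]; have : mdist x z <= r.
    by apply: (mB _ _ Bx Bz).1.
  by have := metric_triangle x z y; lra.
move=> x y ABx ABy; split.
  move=> fxy.
  have close z : (A `|` B) z -> (exists2 a, A a & f z = inl (l a) /\
      mdist z a < h / 2) \/ (B z /\ f z = inr (m z)).
    move=> /hinl[[Az fz]|[_ [Bz [[a za fz]|[_ fz]]]]].
    - by left; exists z => //; rewrite mdistxx; split=> //; lra.
    - by left; exists a; [have [] := za|split=> //; exact: near].
    - by right.
  case: (close _ ABx) => [[a Aa [fx xa]]|[Bx fx]];
      case: (close _ ABy) => [[b Ab [fy yb]]|[By fy]].
  - have : mdist a b <= e by apply: (lA _ _ Aa Ab).1; move: fxy; rewrite fx fy => -[].
    have := metric_triangle x a y; have := metric_triangle a b y.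
    by rewrite (metric_sym b y); lra.
  - by move: fxy; rewrite fx fy.
  - by move: fxy; rewrite fx fy.
  - have : mdist x y <= r by apply: (mB _ _ Bx By).1; move: fxy; rewrite fx fy => -[].
    by lra.
rewrite lt_min => /andP[xye xyt].
case: (hinl _ ABx) => [[Ax fx]|[nAx [Bx fx]]];
    case: (hinl _ ABy) => [[Ay fy]|[nAy [By fy]]].
- by rewrite fx fy; congr inl; apply: (lA _ _ Ax Ay).2; lra.
- have yx : att y x by split=> //; exists y; rewrite metric_sym.
  case: fy => [[z yz fy]|[/(_ x)//]].
  by rewrite fx fy; congr inl; exact: attP (By) (By) erefl yx yz.
- have xy : att x y by split=> //; exists x.
  case: fx => [[z xz fx]|[/(_ y)//]].
  by rewrite fx fy; congr inl; exact: attP (Bx) (Bx) erefl xz xy.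
- have mxy : m x = m y by apply: (mB _ _ Bx By).2.
  case: fx => [[z xz fx]|[nx fx]]; case: fy => [[w yw fy]|[ny fy]].
  + by rewrite fx fy; congr inl; exact: attP Bx By mxy xz yw.
  + by case: (ny z); exact: attE xz.
  + by case: (nx w); exact: attE (esym mxy) yw.
  + by rewrite fx fy mxy.
Qed.

(** One [e] bounds both the fragments and the size of the remainder [O], and one gap [h] serves all
    families. Being thin for [n] and [s] corresponds to an [n]th inductive dimension of at most
    [s + n]. *)
Definition thin_at n (s e : R) X :=
  exists (h : R) (A : nat -> set K) (O : set K),
    [/\ 0 < h, forall i, (i < n)%N -> fragmented h e (A i), open O,
        small_cover s e O &
        forall x, X x -> (exists2 i, (i < n)%N & A i x) \/ O x].

Definition thin n (s : R) X := forall e : R, 0 < e -> thin_at n s e X.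

Lemma thin_at_le n s e e' X : e <= e' -> thin_at n s e X -> thin_at n s e' X.
Proof.
move=> ee' [h [A [ O [h0 Ae oO Os XAO]]]]; exists h, A, O; split=> //.
- by move=> i ni; apply: fragmented_sub (Ae _ ni).
- exact: small_cover_sub Os.
Qed.

Lemma thin_sub n s X Y : Y `<=` X -> thin n s X -> thin n s Y.
Proof.
move=> YX Xn e /Xn[h [A [ O [h0 Ae oO Os XAO]]]].
by exists h, A, O; split=> // x /YX/XAO.
Qed.

Lemma thin_set0 n s : thin n s set0.
Proof.
move=> e e0; exists 1, (fun=> set0), set0; split=> // [i _||].
- by exists unit, (fun=> tt).
- exact: open0.
- exact: small_cover_set0 (ltW e0).
Qed.

(** The scale for [Y] is chosen after the gap for [X], so small that the fragments of each [B i] can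
    be glued to those of [A i]. *)
Lemma thin_setU n s X Y : thin n s X -> thin n s Y -> thin n s (X `|` Y).
Proof.
move=> Xn Yn e e0.
have e40 : 0 < e / 4 by rewrite divr_gt0.
have [h [A [ O [h0 Ae oO Os XAO]]]] := Xn _ e40.
pose k := Num.min h (e / 2).
have k0 : 0 < k by rewrite lt_min h0/= divr_gt0.
have r0 : 0 < k / 4 by rewrite divr_gt0.
have [th [B [V [th0 Br oV Vs YBV]]]] := Yn _ r0.
have ke : k <= e / 2 by rewrite ge_min lexx orbT.
exists (Num.min (k / 4) th), (fun i => A i `|` B i), (O `|` V).
split; first by rewrite lt_min r0.
- move=> i ni; have Ai : fragmented k (e / 4) (A i).
    by apply: fragmented_sub (Ae _ ni) => //; rewrite ge_min lexx.
  apply: fragmented_sub (fragmented_setU k0 _ _ Ai (Br _ ni)) => //; lra.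
- exact: openU.
- apply: small_cover_setU => //; first exact: ltW.
  apply: small_cover_sub Vs => //; lra.
- move=> x [/XAO|/YBV] [[i ni ix]|ix]; [left; exists i=> //; by left|by right; left|
    left; exists i=> //; by right|by right; right].
Qed.

Lemma thin_bigcup_fset n s (I : choiceType) (D : {fset I}) (X : I -> set K) :
  (forall i, i \in D -> thin n s (X i)) ->
  thin n s (\bigcup_(i in [set` D]) X i).
Proof.
move=> Dn.
have H (r : seq I) : {subset r <= D} -> thin n s (\bigcup_(i in [set` r]) X i).
  elim: r => [_|a r IH ar].
    by rewrite set_nil bigcup_set0; exact: thin_set0.
  apply: thin_sub (thin_setU (Dn a _) (IH _)).
  - move=> x [i /=]; rewrite inE => /predU1P[->|ir] Xi; first by left.
    by right; exists i.
  - by apply: ar; rewrite mem_head.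
  - by move=> i ir; apply: ar; rewrite inE ir orbT.
by apply: thin_sub (H D (fun _ => id)).
Qed.

End thin.

(** * Thin sets and the inductive dimension *)

Section subspace.
Context {R : realType} {K : metricType R} (X : set K).
Implicit Types (V : set (set_type X)) (x : set_type X).

Lemma open_subspaceP V :
  open V <-> exists2 W : set K, open W & V = set_val @^-1` W.
Proof. by split=> -[W oW VW]; exists W. Qed.

Lemma nbhs_subspaceP x V : nbhs x V <->
  exists2 r : R, 0 < r & forall y, mdist (set_val x) (set_val y) < r -> V y.
Proof.
rewrite nbhsE; split=> [[W [/open_subspaceP[W' /open_mdistP oW' ->] Wx] WV]|[r r0 rV]].
  by have [r r0 rW] := oW' _ Wx; exists r => // y xy; apply: WV; exact: rW.
exists (set_val @^-1` (thicken r [set set_val x])).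
  split; last by exists (set_val x); rewrite ?mdistxx.
  by apply/open_subspaceP; exists (thicken r [set set_val x]) => //; exact: thicken_open.
by move=> y [_ ->]; exact: rV.
Qed.

Lemma boundary_compact V : compact X -> compact (set_val @` boundary V).
Proof.
move=> cX; have : open (~` boundary V).
  rewrite openC; apply: closedI; first exact: closed_closure.
  by rewrite closedC; exact: open_interior.
move=> /open_subspaceP[W oW VW].
have -> : set_val @` boundary V = X `&` ~` W.
  have VWE x : boundary V x <-> ~ W (set_val x).
    have -> : W (set_val x) = (~` boundary V) x by rewrite VW.
    by split=> [? //|/contrapT].
  apply/seteqP; split=> [_ [x /VWE nW <-]|y [Xy nW]].
    by split=> //; exact: set_valP.
  by exists (SigSub (mem_set Xy)) => //; apply/VWE.
by apply: compact_closedI => //; rewrite closedC.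
Qed.

Lemma notin_boundary V x : ~ boundary V x -> exists2 r : R, 0 < r &
  forall y, mdist (set_val x) (set_val y) < r -> (V y <-> V x).
Proof.
move=> nV; have [Vx|nVx] := pselect (interior V x).
  move: (Vx) => /nbhs_subspaceP[r r0 rV]; exists r => // y xy.
  by split=> _; [exact: nbhs_singleton|exact: rV].
have : ~ closure V x by move=> Vx; apply: nV.
have : open (~` closure V) by rewrite openC; exact: closed_closure.
rewrite openE => oV nx; have /nbhs_subspaceP[r r0 rV] := oV _ nx.
exists r => // y xy; split=> V'; exfalso.
  by apply: (rV _ xy); exact: subset_closure.
by apply: nx; exact: subset_closure.
Qed.

End subspace.

Section inductive_dimension.
Context {R : realType} {K : metricType R}.
Implicit Types (A X Y : set K).

(* Points outside a neighbourhood of the boundaries of finitely many small open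
   sets are sorted by their membership in these sets. *)
Lemma thinS n s X : compact X ->
  (forall (x : set_type X) (e : R), 0 < e -> exists U : set (set_type X),
    [/\ open U, U x, forall y z, U y -> U z -> mdist (set_val y) (set_val z) <= e
      & thin n s (set_val @` boundary U)]) ->
  thin n.+1 s X.
Proof.
move=> cX XU e e0; have e20 : 0 < e / 2 by rewrite divr_gt0.
have /choice[U UP] := fun x => XU x e e0.
have /choice[V VP] : forall x, exists W : set K, open W /\ U x = set_val @^-1` W.
  by move=> x; have [/open_subspaceP[W ? ?] _ _ _] := UP x; exists W.
have UVE x (y : set_type X) : U x y <-> V x (set_val y) by rewrite (VP x).2.
have [||D XD] := compact_finite_cover cX (V := V).
- by move=> x; exact: (VP x).1.
- move=> x Xx; exists (SigSub (mem_set Xx)) => //.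
  by apply/(UVE _ (SigSub (mem_set Xx))); have [] := UP (SigSub (mem_set Xx)).
have bD : thin n s (\bigcup_(x in [set` D]) (set_val @` boundary (U x))).
  by apply: thin_bigcup_fset => x _; have [] := UP x.
(* Scale [e / 2] leaves room for the thickening below, which adds at most [h / 2 <= e / 2] to the
   diameters. *)
have [h' [A [ O [h'0 Ae' oO Os bAO]]]] := bD _ e20.
pose h := Num.min h' e; have h0 : 0 < h by rewrite lt_min h'0.
have he : h <= e by rewrite ge_min lexx orbT.
have Ae i : (i < n)%N -> fragmented h (e / 2) (A i).
  by move=> /Ae'; apply: fragmented_sub => //; rewrite ge_min lexx.
pose W := (\bigcup_(i in `I_n) thicken (h / 4) (A i)) `|` O.
have h40 : 0 < h / 4 by rewrite divr_gt0.
have oW : open W.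
  apply: openU => //; apply: bigcup_open => i _; exact: thicken_open.
pose Z := X `&` ~` W.
have cZ : compact Z by apply: compact_closedI => //; rewrite closedC.
pose l x : {ffun D -> bool} := [ffun t => `[< V (fsval t) x >]].
(* Off the boundaries the membership pattern [l] is locally constant; compactness of [Z] makes the
   radius uniform. *)
have [r r0 rl] : exists2 r : R, 0 < r &
    forall x y, Z x -> Z y -> mdist x y < r -> l x = l y.
  have [|r r0 rZ] := @lebesgue_number _ _ _ (fun i => [set y | Z y -> l y = i]) _ cZ.
    move=> x [Xx nWx]; exists (l x); apply/nbhs_mdist_lt.
    have [t w w' _ w'w H y xy|t|r r0 rP] := @fin_common_radius R D
      (fun t r => forall y : set_type X, mdist x (set_val y) < r ->
                  (U (fsval t) y <-> V (fsval t) x)).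
    - by apply: H; exact: lt_le_trans xy w'w.
    - have [|w w0 wP] := @notin_boundary _ _ _ (U (fsval t)) (SigSub (mem_set Xx)).
        move=> bx; apply: nWx.
        have [|[i ni Aix]|Ox] := bAO x; last by right.
          exists (fsval t); first exact: fsvalP.
          by exists (SigSub (mem_set Xx)).
        by left; exists i => //; exact: sub_thicken.
      by exists w => // y xy; rewrite (wP y xy) UVE.
    exists r => // y xy [Xy _]; apply/ffunP => t; rewrite !ffunE.
    have := rP t (SigSub (mem_set Xy)) xy; rewrite UVE /= => H.
    by apply/asboolP/asboolP => /H.
  exists r => // x y Zx Zy xy; have [i iP] := rZ _ Zx.
  by rewrite (iP x) ?mdistxx// (iP y).
pose B i := if (i < n)%N then thicken (h / 4) (A i) else Z.
exists (Num.min (h / 2) r), B, O; split=> //.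
- by rewrite lt_min r0 andbT divr_gt0.
- move=> i _; rewrite /B; case: ifPn => [/Ae /(fragmented_thicken h0)|_].
    by apply: fragmented_sub => //; [rewrite ge_min lexx|lra].
  exists {ffun D -> bool}, l => x y Zx Zy; split; last first.
    by rewrite lt_min => /andP[_]; exact: rl.
  (* Points of [Z] with equal patterns lie in a common member of the cover, whose diameter is at
     most [e]. *)
  move=> lxy; have [t tD Vtx] := XD _ Zx.1.
  have : l x [` tD]%fset = l y [` tD]%fset by rewrite lxy.
  rewrite !ffunE (asboolT Vtx) => /esym/asboolP Vty.
  have [_ _ Ut _] := UP t.
  by apply: (Ut (SigSub (mem_set Zx.1)) (SigSub (mem_set Zy.1))); exact/UVE.
- apply: small_cover_sub Os => //; lra.
- move=> x Xx; have [[[i ni ix]|Ox]|nWx] := pselect (W x); [|by right|].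
    by left; exists i; [exact: leqW|rewrite /B ni].
  by left; exists n => //; rewrite /B ltnn.
Qed.

Lemma dimtH_thin n s X : 0 < s -> compact X ->
  (dimtH n X < (s + n%:R)%:E)%E -> thin n s X.
Proof.
move=> s0; elim: n X => [|n IH] X cX /=.
  rewrite addr0 => Xs e e0.
  have : small_cover s e X.
    apply: dimH_lt_small_cover => //; move: Xs; case: ifPn => // /eqP -> _.
    by rewrite /dimH eqxx lte_fin; lra.
  move=> /small_cover_open[ O [oO XO Os]].
  by exists 1, (fun=> set0), O; split=> // x /XO; right.
case: ifPn => [/eqP -> _|_]; first exact: thin_set0.
move=> /ereal_inf_lt[d [B [Bo bB] BU] ds]; apply: thinS => // x e e0.
have [U [BU' Ux] Ue] : filter_from [set U | B U /\ U x] id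
    [set y | mdist (set_val x) (set_val y) < e / 2].
  apply: bB; apply/nbhs_subspaceP; exists (e / 2) => [|y //]; lra.
exists U; split=> //; first exact: Bo.
  move=> y z /Ue /= xy /Ue /= xz; have := metric_triangle (set_val y) (set_val x) (set_val z).
  by rewrite (metric_sym (set_val y) (set_val x)); lra.
apply: IH; first exact: boundary_compact.
apply: le_lt_trans (BU _ BU') _.
case: d ds {BU} => [d| |]//= => [dn|_]; last by rewrite ltNyr.
by move: dn; rewrite -EFinB !lte_fin -natr1; lra.
Qed.

(** A state of the separation process: two sets and a positive lower bound for their distance. *)
Let gap (t : set K * set K * R) := 0 < t.2 /\
  forall p q, t.1.1 p -> t.1.2 q -> t.2 <= mdist p q.

(** One growth step: the fragments of the last family that come close to [P] join [P], its other
    fragments join [Q]. This uses up the last family, so the points left over need only the first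
    [n]. *)
Lemma thin_separationS n s X k t : thin n.+1 s X -> gap t -> exists t', [/\ gap t',
  t.1.1 `<=` t'.1.1, t.1.2 `<=` t'.1.2, open t'.1.1 /\ open t'.1.2 &
  thin_at n s k.+1%:R^-1 (X `\` (t'.1.1 `|` t'.1.2))].
Proof.
case: t => -[P Q] d Xn [/= d0 PQ].
(* A fragment of diameter at most [d / 4] that comes within [d / 4] of [P] stays at least [d / 2]
   away from [Q]. *)
pose r := Num.min (d / 4) k.+1%:R^-1.
have r0 : 0 < r by rewrite lt_min divr_gt0//= invr_gt0 ltr0n.
have rd : r <= d / 4 by rewrite ge_min lexx.
have [h [A [ O [h0 Ar oO Os XAO]]]] := Xn _ r0.
have [T [l lA]] := Ar n (ltnSn n).
pose att x := exists2 y, A n y /\ l y = l x & exists2 p, P p & mdist y p < r.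
pose SP := P `|` [set x | A n x /\ att x].
pose SQ := Q `|` [set x | A n x /\ ~ att x].
pose c := Num.min r h.
have c0 : 0 < c by rewrite lt_min r0.
have cr : c <= r by rewrite ge_min lexx.
have ch : c <= h by rewrite ge_min lexx orbT.
have SPQ p q : SP p -> SQ q -> c <= mdist p q.
  move=> [Pp|[Ap [y [Ay ly] [p' Pp' yp']]]] [Qq|[Aq nq]].
  - by have := PQ _ _ Pp Qq; lra.
  - rewrite leNgt; apply/negP => pq; apply: nq; exists q => //; exists p => //.
    by rewrite metric_sym; lra.
  - have := PQ _ _ Pp' Qq; have : mdist y p <= r by apply: (lA _ _ Ay Ap).1.
    have := metric_triangle p' y q; have := metric_triangle y p q.
    by rewrite (metric_sym p' y); lra.
  - rewrite leNgt; apply/negP => pq; apply: nq; exists y; last by exists p'.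
    by split=> //; rewrite ly; apply: (lA _ _ Ap Aq).2; lra.
have c40 : 0 < c / 4 by rewrite divr_gt0.
exists (thicken (c / 4) SP, thicken (c / 4) SQ, c / 2); split=> /=.
- split; rewrite /= ?divr_gt0// => p q [p' Pp' pp'] [q' Qq' qq'].
  have := SPQ _ _ Pp' Qq'; have := metric_triangle p' p q'.
  by have := metric_triangle p q q'; rewrite (metric_sym q q'); lra.
- by move=> x Px; apply: sub_thicken => //; left.
- by move=> x Px; apply: sub_thicken => //; left.
- by split; exact: thicken_open.
apply: thin_at_le (_ : r <= _) _; first by rewrite ge_min lexx orbT.
exists h, A, O; split=> // [i ni|x [Xx nx]]; first by apply: Ar; exact: leqW.
have [[i]|] := XAO _ Xx; last by right.
rewrite ltnS leq_eqVlt => /predU1P[->|ni] Aix; last by left; exists i.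
exfalso; apply: nx; have [ax|nax] := pselect (att x).
  by left; apply: sub_thicken => //; right.
by right; apply: sub_thicken => //; right.
Qed.

(** [P] and [Q] are unions of the growing pairs, disjoint because every stage has a positive gap. A
    point outside both is left over at every stage [k], hence at every scale. *)
Lemma thin_separation n s X x0 r : 0 < r -> thin n.+1 s X ->
  exists P Q : set K, [/\ open P /\ open Q, P x0, forall y, r <= mdist x0 y -> Q y,
    forall y, P y -> Q y -> False & thin n s (X `\` (P `|` Q))].
Proof.
move=> r0 Xn.
pose t0 := ([set y | mdist x0 y <= r / 3], [set y | r <= mdist x0 y], r / 3).
have gap0 : gap t0.
  split=> /= [|p q xp xq]; first by rewrite divr_gt0.
  by have := metric_triangle x0 p q; lra.
have /choice[F FP] : forall kt : nat * (set K * set K * R), exists t', gap kt.2 ->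
    [/\ gap t', kt.2.1.1 `<=` t'.1.1, kt.2.1.2 `<=` t'.1.2,
        open t'.1.1 /\ open t'.1.2 &
        thin_at n s kt.1.+1%:R^-1 (X `\` (t'.1.1 `|` t'.1.2))].
  move=> [k t]; have [gt|ngt] := pselect (gap t); last by exists t.
  by have [t' t'P] := thin_separationS k Xn gt; exists t'.
pose fix t k := if k is k'.+1 then F (k', t k') else t0.
have gt k : gap (t k) by elim: k => // k IH; have [] := FP (k, t k) IH.
have mono i j : (i <= j)%N -> (t i).1.1 `<=` (t j).1.1 /\ (t i).1.2 `<=` (t j).1.2.
  move=> /subnK <-; elim: (j - i)%N => [|k [IH1 IH2]]; first by rewrite add0n; split.
  rewrite addSn.
  have [_ H1 H2 _ _] := FP ((k + i)%N, t (k + i)%N) (gt _).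
  by split; [exact: subset_trans H1|exact: subset_trans H2].
exists (\bigcup_k (t k.+1).1.1), (\bigcup_k (t k.+1).1.2); split.
- by split; apply: bigcup_open => k _; have [_ _ _ []] := FP (k, t k) (gt k).
- exists 0%N => //; apply: (mono 0%N 1%N isT).1 => /=.
  by rewrite mdistxx divr_ge0// ltW.
- by move=> y xy; exists 0%N => //; exact: (mono 0%N 1%N isT).2.
- move=> y [i _ Pi] [j _ Qj].
  have [c0 cm] := gt (maxn i.+1 j.+1).
  have := cm y y ((mono _ _ (leq_maxl _ _)).1 _ Pi) ((mono _ _ (leq_maxr _ _)).2 _ Qj).
  by rewrite mdistxx leNgt c0.
move=> e e0.
have [k ke] := natSinv_le e0.
have [_ _ _ _ H] := FP (k, t k) (gt k).
have [h [A [ O [h0 Ak oO Os XAO]]]] := thin_at_le ke H.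
exists h, A, O; split=> // x [Xx nx]; apply: XAO; split=> // nPQ; apply: nx.
by case: nPQ => ?; [left|right]; exists k.
Qed.

Lemma thin_dimtH n s X : 0 < s -> thin n s X ->
  (dimtH n X <= (s + n%:R)%:E)%E.
Proof.
move=> s0; elim: n X => [|n IH] X Xn /=.
  case: ifPn => _; first by rewrite lee_fin; lra.
  rewrite addr0; apply: small_cover_dimH; first exact: ltW.
  move=> s' e ss' e0; pose e1 := Num.min e 1.
  (* A total of at most 1 allows passing from the exponent [s] to [s']. *)
  have e10 : 0 < e1 by rewrite lt_min e0/=.
  have [h [A [ O [_ _ _ Os XO]]]] := Xn _ e10.
  apply: (@small_cover_sub _ _ s' e1 e O); first by rewrite ge_min lexx.
    by move=> x /XO[[]|].
  by apply: small_cover_exp Os => //; [exact: ltW|rewrite ge_min lexx orbT].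
case: ifPn => [_|X0]; first by rewrite lee_fin; have := ler0n R n.+1; lra.
(* The basis consists of all open sets with thin boundary. [P] is one of them: [P] and [Q] are open
   and disjoint, so the boundary of [P] misses both. *)
apply: ereal_inf_lbound; exists [set U | open U /\ thin n s (set_val @` boundary U)].
  split=> [U [] //|x N /nbhs_subspaceP[r r0 rN]].
  have [P [Q [[oP oQ] Px rQ PQ XPQ]]] := thin_separation (set_val x) r0 Xn.
  exists (set_val @^-1` P).
    split=> //; have oU : open (set_val @^-1` P : set (set_type X)).
      by apply/open_subspaceP; exists P.
    split=> //; apply: thin_sub XPQ => _ [y [cy ny] <-]; split; first exact: set_valP.
    move=> [Py|Qy]; first by apply: ny; rewrite /interior; exact: open_nbhs_nbhs.
    have /cy[z [Pz Qz]] : nbhs y (set_val @^-1` Q).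
      by apply: open_nbhs_nbhs; split=> //; apply/open_subspaceP; exists Q.
    exact: PQ Pz Qz.
  move=> y /= Py; apply: rN; rewrite ltNge; apply/negP => /rQ Qy.
  exact: PQ Py Qy.
move=> U [_ Un]; apply: le_trans (IH _ Un) _.
by rewrite -EFinB lee_fin -natr1; lra.
Qed.

(** Both dimensions follow the same recursion, and at level 0 a non-empty set has non-negative
    Hausdorff dimension. This turns [n <= dimt] into [n <= dimtH n]. *)
Lemma dimtH_lt_dimt_lt n X : (dimtH n X < n%:R%:E)%E -> dimt_lt n X.
Proof.
elim: n X => [|n IH] X /=; have [->|X0] := eqVneq X set0.
- by [].
- by rewrite ltNge dimH_ge0//; exact/set0P.
- by move=> _; exact: (@dimt_ltW R K 0%N n.+1 set0 (leq0n _) erefl).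
move=> /ereal_inf_lt[d [B bB BU] dn]; exists B => // U BU'.
apply: IH; apply: le_lt_trans (BU _ BU') _.
case: d dn {BU} => [d| |]//= => [dn|_]; last by rewrite ltNyr.
by move: dn; rewrite -EFinB !lte_fin -natr1; lra.
Qed.

End inductive_dimension.

(** * The space of continuous maps *)

Section contfun_theory.
Context {R : realType} {K : metricType R} {n : nat}.

Lemma mx_norm_ltP (v : 'rV[R]_n) (e : R) : 0 < e ->
  `|v| < e <-> forall i, `|v ord0 i| < e.
Proof.
move=> e0; rewrite {1}/Num.norm/= mx_normrE; split=> [ve i|ve].
  by have /bigmax_ltP[_ /(_ (ord0, i) isT)] := ve.
by apply/bigmax_ltP; split=> // -[i j] _ /=; rewrite (ord1 i).
Qed.

Lemma mx_norm_leP (v : 'rV[R]_n) (e : R) : 0 <= e ->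
  `|v| <= e <-> forall i, `|v ord0 i| <= e.
Proof.
move=> e0; rewrite {1}/Num.norm/= mx_normrE; split=> [ve i|ve].
  by have /bigmax_leP[_ /(_ (ord0, i) isT)] := ve.
by apply/bigmax_leP; split=> // -[i j] _ /=; rewrite (ord1 i).
Qed.

Lemma contfun_continuous (f : contfun n K) : continuous f.
Proof. exact: (@cts_fun _ _ (f : continuousType K 'rV[R]_n)). Qed.

Lemma contfun_coord_continuous (f : contfun n K) i : continuous (fun x => f x ord0 i).
Proof.
move=> x; apply: (@continuous_comp _ _ _ f (fun v : 'rV[R]_n => v ord0 i)).
  exact: contfun_continuous.
exact: coord_continuous.
Qed.

Lemma contfunP (g : K -> 'rV[R]_n) : continuous g ->
  exists f : contfun n K, forall x, f x = g x.
Proof. by move=> cg; pose f : continuousType K 'rV[R]_n := mkcts cg; exists f. Qed.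

Lemma row_continuous (g : 'I_n -> K -> R) : (forall i, continuous (g i)) ->
  continuous (fun x => \row_i g i x).
Proof.
move=> cg x; apply/cvgrPdist_lt => e e0.
suff [r r0 rP] : exists2 r : R, 0 < r & forall i y, mdist x y < r ->
    `|g i x - g i y| < e.
  apply/nbhs_mdist_lt; exists r => // y xy; apply/mx_norm_ltP => // i.
  by rewrite !mxE; exact: rP.
apply: (@fin_common_radius R 'I_n (fun i r => forall y, mdist x y < r ->
    `|g i x - g i y| < e)) => [i r r' _ rr' H y xy|i].
  by apply: H; exact: lt_le_trans rr'.
by have /cvgrPdist_lt/(_ e e0)/nbhs_mdist_lt := cg i x.
Qed.

Lemma contfun_unif (f : contfun n K) (e : R) : compact [set: K] -> 0 < e ->
  exists2 d : R, 0 < d & forall x y, mdist x y < d -> `|f x - f y| < e.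
Proof.
move=> cK e0.
have [x _|d d0 dP] := @lebesgue_number _ _ _
    (fun z => [set y | `|f z - f y| < e / 2]) _ cK.
  exists x; have /cvgrPdist_lt := @contfun_continuous f x.
  by apply; rewrite divr_gt0.
exists d => // x y xy; have [z zP] := dP x I.
have /= zy := zP _ xy; have /= zx : `|f z - f x| < e / 2.
  by apply: zP; rewrite mdistxx.
rewrite (_ : f x - f y = (f z - f y) - (f z - f x)); last first.
  by rewrite opprB [RHS]addrC addrA subrK.
by rewrite (le_lt_trans (ler_normB _ _))// [ltRHS]splitr ltrD.
Qed.

Lemma contfun_nowhere_dense (A : set (contfun n K)) :
  (forall (f : contfun n K) (e : R), 0 < e -> exists2 g : contfun n K,
     forall x, `|f x - g x| < e & exists2 d : R, 0 < d &
     forall h : contfun n K, (forall x, `|g x - h x| < d) -> ~ A h) ->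
  nowhere_dense A.
Proof.
move=> HA; rewrite /nowhere_dense -subset0 => f /nbhs_contfunP[e e0 fe].
have [g fg [d d0 gd]] := HA f e e0.
have [|h [Ah gh]] := fe g fg [set h | forall x, `|g x - h x| < d].
  by apply/nbhs_contfunP; exists d.
exact: gd gh Ah.
Qed.

End contfun_theory.

(** * Separating finitely many fragments by real values *)

Section perturbation.
Context {R : realType}.

Lemma separated_values (T : finType) (v : T -> R) (e : R) : 0 < e ->
  exists (c : T -> R) (w : R), [/\ 0 < w, forall t, `|c t - v t| <= e &
    forall t t', `|c t - c t'| < w -> t = t'].
Proof.
move=> e0; pose N := #|T|.+1; pose w := e / N%:R.
have N0 : (0 : R) < N%:R by rewrite ltr0n.
have w0 : 0 < w by rewrite divr_gt0.
have wN : w * N%:R = e by rewrite divfK// gt_eqF.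
pose q t := Num.floor (v t / e).
(* Round [v t] down to the grid of mesh [e], then add [enum_rank t] steps of size [w]. Ranks are
   below [N], so the residue modulo [N] recovers [t]. *)
pose z t : int := N%:Z * q t + (enum_rank t)%:Z.
exists (fun t => w * (z t)%:~R), w; split=> // [t|t t'].
  have /andP[] := floor_itv (v t / e).
  rewrite -/(q t) intrD ler_pdivlMr// ltr_pdivrMr// => qv vq.
  have -> : w * (z t)%:~R = (q t)%:~R * e + w * (enum_rank t)%:R.
    by rewrite /z intrD intrM -!pmulrn mulrDr mulrA wN mulrC.
  have : w * (enum_rank t)%:R <= w * N%:R.
    by rewrite ler_wpM2l ?(ltW w0)// ler_nat ltnW// ltnW// ltnS ltn_ord.
  have : 0 <= w * (enum_rank t)%:R by rewrite mulr_ge0// ltW.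
  by rewrite wN ler_norml => *; apply/andP; split; lra.
rewrite -mulrBr normrM (gtr0_norm w0) -{2}(mulr1 w) ltr_pM2l// -intrB.
rewrite -intr_norm (_ : 1 = 1%:~R :> R)// ltr_int => zz.
have {}zz : z t = z t' by lia.
apply: enum_rank_inj; apply: val_inj => /=.
have := congr1 (fun k => k %% N%:Z)%Z zz.
rewrite /z ![(N%:Z * _)%R]mulrC !modzMDl !modz_small//=.
- by case.
- by rewrite /= ltz_nat ltnW// ltnS ltn_ord.
- by rewrite /= ltz_nat ltnW// ltnS ltn_ord.
Qed.

Context {K : metricType R}.

(* The values of [g] single out the fragments of [A]: it is constant on each of
   them, except that it is forced to stay close to [phi] elsewhere. *)
Lemma fragmented_perturb (A : set K) (h d e : R) (phi : K -> R) :
  0 < h -> 0 < e -> continuous phi -> fragmented h d A ->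
  (forall x y, mdist x y <= d -> `|phi x - phi y| <= e) ->
  exists (g : K -> R) (w : R), [/\ 0 < w, continuous g,
    forall x, `|phi x - g x| <= 2 * e &
    forall x y, A x -> A y -> `|g x - g y| < w -> mdist x y <= d].
Proof.
move=> h0 e0 cphi [T [l lA]] phie.
have /choice[v vP] : forall t, exists r : R, forall x, A x -> l x = t ->
    `|r - phi x| <= e.
  move=> t; have [[x [Ax xt]]|nt] := pselect (exists x, A x /\ l x = t); last first.
    by exists 0 => x Ax xt; case: nt; exists x.
  by exists (phi x) => y Ay yt; apply: phie; apply: (lA _ _ Ax Ay).1; rewrite xt.
have [c [w [w0 cv cw]]] := separated_values v e0.
(* On [A] only the summand of the point's own fragment survives: the other fragments are at least
   [h] away, so its quotient is 1, and all other quotients vanish. *)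
pose C x := \sum_(t : T) c t * (capdist h [set a | A a /\ l a <> t] x / h).
(* The clamp is inactive on [A], where [c (l x)] is already within [2 * e] of [phi x]. *)
pose g x := phi x + Num.max (- (2 * e)) (Num.min (2 * e) (C x - phi x)).
have CA x : A x -> C x = c (l x).
  move=> Ax; rewrite /C (bigD1 (l x))//= big1 ?addr0 => [|t tx].
    rewrite capdistT ?divff ?mulr1 ?gt_eqF ?ltW// => a [Aa xa].
    by rewrite leNgt; apply/negP => ah; apply: xa; rewrite (lA _ _ Ax Aa).2.
  rewrite capdist0 ?mul0r ?mulr0 ?ltW//; split=> //.
  by apply/eqP; rewrite eq_sym.
have gA x : A x -> g x = c (l x).
  move=> Ax; rewrite /g CA//.
  have := cv (l x); have := vP _ _ Ax erefl; rewrite !ler_norml.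
  move=> /andP[? ?] /andP[? ?].
  rewrite min_r; last by lra.
  by rewrite max_r; [rewrite addrC subrK|lra].
exists g, w; split=> //.
- move=> x; apply: (@continuousD R R^o K phi
    (fun x => Num.max (- (2 * e)) (Num.min (2 * e) (C x - phi x)))).
    exact: cphi.
  apply: (@continuous_max R K); first exact: cst_continuous.
  apply: (@continuous_min R K); first exact: cst_continuous.
  apply: (@continuousB R R^o K C phi); last exact: cphi.
  rewrite /C; apply: (@continuous_big R T +%R 0 xpredT) => [|t _ y].
    exact: add_continuous.
  apply: (@continuousM R K); first exact: cst_continuous.
  apply: (@continuousM R K); last exact: cst_continuous.
  by apply: capdist_continuous; exact: ltW.
- move=> x; rewrite /g opprD addNKr normrN ler_norml ge_max le_max lexx /= .
  by rewrite ge_min lexx andbT; lra.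
- move=> x y Ax Ay; rewrite !gA// => /cw lxy.
  exact: (lA _ _ Ax Ay).1.
Qed.

End perturbation.

(** * Fibers of generic maps *)

Section generic_fibers.
Context {R : realType} {K : metricType R}.

Lemma nowhere_dense_sub (T : topologicalType) (A B : set T) : A `<=` B ->
  nowhere_dense B -> nowhere_dense A.
Proof.
move=> AB; rewrite /nowhere_dense -!subset0; apply: subset_trans.
exact/interiorS/closureS.
Qed.

Lemma card_gt_inj (T : choiceType) (A : set T) n : ~ (A #<= `I_n)%card ->
  exists x : 'I_n.+1 -> T, injective x /\ forall i, A (x i).
Proof.
move=> nA; have [D DA nD] : exists2 D : {fset T}, [set` D] `<=` A & (n < #|` D|)%N.
  have [fA|/(@infinite_set_fset _ _ n.+1)[D DA nD]] := pselect (finite_set A); last first.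
    by exists D.
  move: (fA) => /finite_setP[m Am]; exists (fset_set A); first by rewrite fset_setK.
  rewrite (card_fset_set Am) ltnNge; apply/negP => mn; apply: nA.
  have /card_eqPle[AIm _] := Am.
  by apply: card_le_trans AIm _; rewrite card_le_II.
have [x0 x0D] : exists x0, x0 \in D.
  by apply/fset0Pn; rewrite -cardfs_eq0 -lt0n (leq_trans _ nD).
exists (fun i => nth x0 D i); split=> [i j /eqP|i].
  rewrite nth_uniq ?fset_uniq//; first by move=> /eqP/val_inj.
  - exact: leq_trans (ltn_ord i) nD.
  - exact: leq_trans (ltn_ord j) nD.
by apply: DA => /=; rewrite mem_nth//; exact: leq_trans (ltn_ord i) nD.
Qed.

Lemma thin_generic n (t : R) : compact [set: K] -> 0 <= t ->
  (forall s, t < s -> thin n s [set: K]) ->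
  exists2 G : set K, (dimH G <= t%:E)%E &
    comeager [set f : contfun n K |
      forall y : 'rV[R]_n, ((f @^-1` [set y]) `\` G #<= `I_n)%card].
Proof.
move=> cK t0 Kn.
(* The [e m] are summable and [s m] tends to [t], so tails of the remainders cover [G] with small
   total in every dimension above [t]. *)
pose s m : R := t + m.+1%:R^-1; pose e m : R := (2 ^ m.+1)%:R^-1.
have e0 m : 0 < e m by rewrite invr_gt0 ltr0n expn_gt0.
have em m : e m < m.+1%:R^-1.
  by rewrite ltf_pV2 ?posrE ?ltr0n ?expn_gt0// ltr_nat; exact: ltn_expl.
have /choice[a aP] : forall m, exists p : R * (nat -> set K) * set K,
    [/\ 0 < p.1.1, forall i, (i < n)%N -> fragmented p.1.1 (e m) (p.1.2 i),
        small_cover (s m) (e m) p.2 &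
        forall x, (exists2 i, (i < n)%N & p.1.2 i x) \/ p.2 x].
  move=> m; have [|h [A [ O [h0 Ae oO Os AO]]]] := Kn (s m) _ _ (e0 m).
    by rewrite ltrDl invr_gt0 ltr0n.
  by exists (h, A, O); split=> // x; exact: AO.
pose O m := (a m).2; pose A m := (a m).1.2; pose h m := (a m).1.1.
pose G := \bigcap_M \bigcup_k O (M + k)%N.
exists G.
  apply: small_cover_dimH => // s' c ts' c0.
  have [|M Mle] := @natSinv_le _ (Num.min c (s' - t)); first by rewrite lt_min c0 subr_gt0.
  apply: (@small_cover_sub _ _ _ c c (\bigcup_k O (M + k)%N)) => //.
    by move=> x; apply.
  apply: small_cover_bigcup => [|k]; first exact: ltW.
  have [_ _ Os _] := aP (M + k)%N.
  apply: (@small_cover_sub _ _ s' (e (M + k)%N) _ (O (M + k)%N)) => //.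
    rewrite /e -addnS expnD natrM invfM ler_wpM2r ?invr_ge0//.
    apply: le_trans (_ : M.+1%:R^-1 <= _).
      by rewrite lef_pV2 ?posrE ?ltr0n ?expn_gt0// ler_nat; exact: ltn_expl.
    by apply: le_trans Mle _; rewrite ge_min lexx.
  apply: small_cover_exp Os => //.
  - by rewrite /s; apply: ltr_wpDl => //; rewrite invr_gt0 ltr0n.
  - rewrite /s -lerBrDl; apply: le_trans (_ : M.+1%:R^-1 <= _).
      by rewrite lef_pV2 ?posrE ?ltr0n// ler_nat ltnS leq_addr.
    by apply: le_trans Mle _; rewrite ge_min lexx orbT.
  - by rewrite invf_le1 ?ltr0n ?expn_gt0// ler1n expn_gt0.
(* Every map having a fiber with more than [n] points off [G] lies in some [bad (q, M)]; fixing the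
   separation and the first index makes each of these sets nowhere dense. *)
pose bad (qM : nat * nat) : set (contfun n K) := [set f | exists x : 'I_n.+1 -> K,
  [/\ forall i k, ~ O (qM.2 + k)%N (x i),
      forall i j, i != j -> qM.1.+1%:R^-1 <= mdist (x i) (x j) &
      forall i, f (x i) = f (x ord0)]].
have bad_nd qM : nowhere_dense (bad qM).
  case: qM => q M; apply: contfun_nowhere_dense => f c c0.
  have c40 : 0 < c / 4 by rewrite divr_gt0.
  have [d d0 fd] := contfun_unif f cK c40.
  have [k kd] := natSinv_le d0.
  (* Stage [m] is so late that the bad points avoid [O m], that fragments are smaller than the
     separation [1 / (q + 1)], and that [f] varies little on them. *)
  pose m := maxn M (maxn q k).
  have mM : (M <= m)%N by rewrite leq_maxl.
  have emq : e m < q.+1%:R^-1.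
    apply: lt_le_trans (em m) _; rewrite lef_pV2 ?posrE ?ltr0n// ler_nat ltnS.
    by rewrite leq_max leq_maxl orbT.
  have emd : e m < d.
    apply: lt_le_trans (em m) _; apply: le_trans kd.
    by rewrite lef_pV2 ?posrE ?ltr0n// ler_nat ltnS leq_max leq_maxr orbT.
  have [h0 Am _ AO] := aP m.
  have /choice[g gP] : forall i : 'I_n, exists gw : (K -> R) * R, [/\ 0 < gw.2,
      continuous gw.1, forall x, `|f x ord0 i - gw.1 x| <= 2 * (c / 4) &
      forall x y, A m i x -> A m i y -> `|gw.1 x - gw.1 y| < gw.2 ->
        mdist x y <= e m].
    move=> i; have [|g [w [w0 cg fg gA]]] := fragmented_perturb h0 c40
      (contfun_coord_continuous (f := f) (i := i)) (Am i (ltn_ord i)).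
      move=> x y xy; apply/ltW.
      have /(mx_norm_ltP _ c40)/(_ i) := fd x y (le_lt_trans xy emd).
      by rewrite !mxE.
    by exists (g, w).
  have [g' g'E] : exists g' : contfun n K, forall x, g' x = \row_i (g i).1 x.
    by apply: contfunP; apply: row_continuous => i; have [] := gP i.
  have [|i|w w0 wP] := @fin_common_radius R 'I_n (fun i w => w <= (g i).2).
  - by move=> i w w' _ w'w; exact: le_trans.
  - by exists (g i).2 => //; have [] := gP i.
  exists g' => [x|].
    rewrite g'E; apply/mx_norm_ltP => // i; rewrite !mxE.
    have [_ _ /(_ x) + _] := gP i; lra.
  exists (w / 2); first by rewrite divr_gt0.
  move=> f' gf' [x [xO xq xf]].
  have /choice[col colP] : forall i, exists j : 'I_n, A m j (x i).
    move=> i; have [[j nj Aj]|Oi] := AO (x i); first by exists (Ordinal nj).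
    by exfalso; apply: (xO i (m - M)%N); rewrite subnKC.
  (* Pigeonhole: two of the [n + 1] points fall into the same family. The coordinate of [g'] for
     that family nearly agrees at them, so they share a fragment, which is too small for their
     separation. *)
  have : ~ injective col by move=> /leq_card; rewrite !card_ord ltnn.
  apply => i j cij; apply: contrapT => /eqP ij.
  have : mdist (x i) (x j) <= e m; last first.
    move=> xij; have /= /le_trans/(_ xij) := xq _ _ ij.
    by rewrite leNgt emq.
  have [_ _ _] := gP (col i); apply; [exact: colP|by rewrite cij; exact: colP|].
  have close z : `|(g (col i)).1 z - f' z ord0 (col i)| < w / 2.
    have /mx_norm_ltP := gf' z; rewrite divr_gt0// => /(_ isT (col i)).
    by rewrite g'E !mxE.
  have := close (x i); have := close (x j); rewrite (xf i) (xf j).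
  have /= := wP (col i); rewrite !ltr_norml => ? /andP[? ?] /andP[? ?].
  by apply/andP; split; lra.
have /card_esym/ppcard_eqP[b] := card_nat2.
set S := (X in comeager X).
(* [meager] asks for equality with the union, so each set is cut down to the complement of [S]. *)
exists (fun i => bad (b i) `&` ~` S).
  by move=> i; apply: nowhere_dense_sub (bad_nd (b i)) => f [].
apply/seteqP; split=> [f nSf|f [i _ []//]].
have [y /card_gt_inj[x [xinj xP]]] : exists y, ~ (f @^-1` [set y] `\` G #<= `I_n)%card.
  by apply/existsNP.
(* A point off the limit superior [G] avoids all remainders from some index on. *)
have /choice[M MP] : forall i, exists M, forall k, ~ O (M + k)%N (x i).
  move=> i; have [_ nG] := xP i; move: nG => /existsNP[M /not_implyP[_ nO]].
  by exists M => k Ok; apply: nO; exists k.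
pose N := \max_i M i.
have [||w w0 wP] := @fin_common_radius R ('I_n.+1 * 'I_n.+1)%type
  (fun ij w => ij.1 != ij.2 -> w <= mdist (x ij.1) (x ij.2)).
- by move=> ij w w' _ w'w H /H; exact: le_trans.
- move=> [i j]; have [->|ij] := eqVneq i j; first by exists 1 => //=; rewrite eqxx.
  exists (mdist (x i) (x j)) => //; rewrite mdist_gt0.
  by apply: contra_neq ij => /xinj.
have [q qw] := natSinv_le w0.
exists (b^-1%FUN (q, N)) => //; split=> //; rewrite invK ?inE//.
exists x; split=> [i k|i j ij|i] /=.
- have /subnKC <- : (M i <= N)%N by exact: leq_bigmax.
  by rewrite -addnA; exact: MP.
- by apply: le_trans qw _; exact: (wP (i, j)).
- by have [fi _] := xP i; have [f0 _] := xP ord0; exact: etrans fi (esym f0).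
Qed.
End generic_fibers.

(** * Baire category *)

Section baire.
Context {R : realType} {K : metricType R} {n : nat}.
Implicit Types f g h : contfun n K.

Lemma nowhere_dense_avoid (F : set (contfun n K)) f (e : R) : nowhere_dense F ->
  0 < e -> exists (g : contfun n K) (d : R), [/\ 0 < d, d <= e / 4,
    forall x, `|f x - g x| < e / 2 &
    forall h, (forall x, `|g x - h x| <= d) -> ~ F h].
Proof.
move=> F0 e0.
have : ~ nbhs f (closure F).
  by move=> nf; have : interior (closure F) f by []; rewrite F0.
move=> nf; have [g [fg ng]] : exists g, (forall x, `|f x - g x| < e / 2) /\ ~ closure F g.
  apply: contrapT => H; apply: nf; apply/nbhs_contfunP; exists (e / 2).
    by rewrite divr_gt0.
  by move=> g fg; apply: contrapT => ng; apply: H; exists g.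
have [d d0 dF] : exists2 d : R, 0 < d &
    forall h, (forall x, `|g x - h x| < d) -> ~ F h.
  apply: contrapT => H; apply: ng => B /nbhs_contfunP[d d0 dB].
  apply: contrapT => nFB; apply: H; exists d => // h /dB Bh Fh.
  by apply: nFB; exists h.
exists g, (Num.min (d / 2) (e / 4)); split=> //.
- by rewrite lt_min !divr_gt0.
- by rewrite ge_min lexx orbT.
move=> h gh; apply: dF => x; apply: le_lt_trans (gh x) _.
by rewrite gt_min; apply/orP; left; lra.
Qed.

Lemma rV_cauchy_limit (v : nat -> 'rV[R]_n) (d : nat -> R) :
  (forall e, 0 < e -> exists i, d i < e) ->
  (forall i j, (i <= j)%N -> `|v i - v j| <= d i) ->
  exists l, forall i, `|v i - l| <= d i.
Proof.
move=> dlim vd.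
have : cvg (v @ \oo).
  suff : cauchy (v @ \oo) by exact: cauchy_cvg.
  suff : cauchy_ex (v @ \oo) by exact: cauchy_exP.
  move=> e e0; have [i ie] := dlim e e0.
  exists (v i); exists i => // j /= ij; rewrite -ball_normE /=.
  exact: le_lt_trans (vd _ _ ij) ie.
move=> /cvg_ex[l vl]; exists l => i; apply/ler_addgt0Pr => e e0.
have /cvgrPdist_lt/(_ e e0)[N _ NP] := vl.
have := NP (maxn N i) (leq_maxl _ _); have := vd i (maxn N i) (leq_maxr _ _).
move=> /= H1 H2; rewrite -(subrKA (v (maxn N i))).
by rewrite (le_trans (ler_normD _ _))// lerD// distrC ltW.
Qed.

(** Baire category with closed balls, stored as center and radius in [u i], each avoiding the next
    nowhere dense set. The center moves by less than half the radius while the radius shrinks at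
    least fourfold, so the balls are nested. *)
Lemma comeager_dense (S : set (contfun n K)) f (e : R) : comeager S -> 0 < e ->
  exists2 g, S g & forall x, `|f x - g x| <= e.
Proof.
move=> [F nF SF] e0.
have /choice[P PP] : forall ige : nat * (contfun n K * R),
    exists hd : contfun n K * R, 0 < ige.2.2 -> [/\ 0 < hd.2, hd.2 <= ige.2.2 / 4,
    forall x, `|ige.2.1 x - hd.1 x| < ige.2.2 / 2 &
    forall h, (forall x, `|hd.1 x - h x| <= hd.2) -> ~ F ige.1 h].
  move=> [i [g c]]; have [c0|nc0] := ltP 0 c; last by exists (g, c); rewrite ltNge nc0.
  by have [h [d H]] := nowhere_dense_avoid g (nF i) c0; exists (h, d).
pose fix u i := if i is j.+1 then P (j, u j) else (f, e).
have u0 i : 0 < (u i).2 by elim: i => // i IH; have [] := PP (i, u i) IH.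
have uS i : [/\ 0 < (u i.+1).2, (u i.+1).2 <= (u i).2 / 4,
    forall x, `|(u i).1 x - (u i.+1).1 x| < (u i).2 / 2 &
    forall h, (forall x, `|(u i.+1).1 x - h x| <= (u i.+1).2) -> ~ F i h].
  exact: PP (i, u i) (u0 i).
(* The factor [1 - 2^-1 ^+ k] sums the moves of the centers and keeps all later centers inside ball
   [i]. *)
have uk i k x : `|(u i).1 x - (u (k + i)%N).1 x| <= (u i).2 * (1 - 2^-1 ^+ k) /\
    (u (k + i)%N).2 <= (u i).2 * 2^-1 ^+ k.
  elim: k => [|k [IH1 IH2]].
    by rewrite add0n expr0 !subrr mulr0 normr0 mulr1; split.
  have [_ H1 /(_ x) H2 _] := uS (k + i)%N; rewrite addSn exprS.
  split; last by have := u0 (k + i)%N; lra.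
  rewrite -(subrKA ((u (k + i)%N).1 x)) (le_trans (ler_normD _ _))//.
  by have := u0 i; lra.
have du i j x : (i <= j)%N -> `|(u i).1 x - (u j).1 x| <= (u i).2.
  move=> /subnK <-; have [H _] := uk i (j - i)%N x; apply: le_trans H _.
  by rewrite ler_piMr ?(ltW (u0 i))// gerBl exprn_ge0// invr_ge0.
have ulim c : 0 < c -> exists i, (u i).2 < c.
  move=> c0; have [k kc] := @natSinv_le _ (c / e) (divr_gt0 c0 e0).
  exists k.+1; have ue i : (u i).2 <= e * 2^-1 ^+ i.
    elim: i => [|i IH]; first by rewrite expr0 mulr1.
    by have [_ H _ _] := uS i; rewrite exprS; have := u0 i; lra.
  apply: le_lt_trans (ue _) _; rewrite mulrC -ltr_pdivlMr//.
  apply: lt_le_trans kc; rewrite exprVn ltf_pV2 ?posrE ?exprn_gt0//.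
  by rewrite -natrX ltr_nat ltn_expl.
have /choice[g gP] := fun x => rV_cauchy_limit ulim (fun i j => @du i j x).
have cg : continuous g.
  move=> x; apply/cvgrPdist_lt => c c0.
  have [|i ic] := ulim (c / 3); first by rewrite divr_gt0.
  have c30 : 0 < c / 3 by rewrite divr_gt0.
  have /cvgrPdist_lt/(_ _ c30) := @contfun_continuous _ _ _ (u i).1 x.
  apply: filterS => y uxy.
  rewrite -(subrKA ((u i).1 x)) (le_lt_trans (ler_normD _ _))//.
  rewrite -(subrKA ((u i).1 y) ((u i).1 x)).
  have := ler_normD ((u i).1 x - (u i).1 y) ((u i).1 y - g y).
  by have := gP x i; have := gP y i; rewrite (distrC (g x)); lra.
have [g' g'E] := contfunP cg.
exists g' => [|x]; last by rewrite g'E; exact: (gP x 0%N).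
apply: contrapT => nS; have : (~` S) g' by [].
rewrite SF => -[i _]; have [_ _ _] := uS i; apply => x.
by rewrite g'E; exact: (gP x i.+1).
Qed.

End baire.

(** * From few fiber points off [G] to narrow levels *)

Section P_l_P_w.
Context {R : realType} {K : metricType R}.

(** A singleton has size 0 for [s > 0], so the open enlargements can be given a summable budget. *)
Lemma small_cover_range s (e : R) (f : nat -> K) : 0 < s -> 0 < e ->
  small_cover s e (range f).
Proof.
move=> s0 e0.
have /choice[V VP] : forall k, exists V : set K, [/\ open V, [set f k] `<=` V &
    (diam_pow s V <= diam_pow s [set f k] + (e / (2 ^ k.+1)%:R)%:E)%E].
  by move=> k; apply: diam_pow_open_ext => //; rewrite divr_gt0// ltr0n expn_gt0.
exists V; split=> [k|_ [k _ <-]|]; first by have [] := VP k.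
  by exists k => //; have [_ + _] := VP k; exact.
have := @epsilon_trick R (fun=> 0%E) e xpredT (fun=> lexx _) (ltW e0).
rewrite [X in (_ <= X + _)%E]eseries0// add0e; apply: le_trans.
apply: lee_nneseries => k _; first by move=> _; exact: diam_pow_ge0.
have [_ _ Vk] := VP k; apply: le_trans Vk _; rewrite leeD2r//.
rewrite (@diam_pow_fin _ _ _ _ 0) ?powR0 ?gt_eqF//; first by exists (f k).
apply/eqP; rewrite eq_le diam_ge0 ?andbT; last by exists (f k).
by apply/diam_leP => x y -> ->; rewrite mdistxx.
Qed.

Lemma small_cover_card_le s (e : R) (F : set K) m : 0 < s -> 0 < e ->
  (F #<= `I_m)%card -> small_cover s e F.
Proof.
move=> s0 e0 Fm; have /finite_fsetP[D ->] : finite_set F.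
  by apply/finite_set_leP; exists m.
have [->|/fset0Pn[x0 x0D]] := eqVneq D fset0.
  by rewrite set_fset0; exact: small_cover_set0 (ltW e0).
apply: small_cover_sub (small_cover_range (nth x0 D) s0 e0) => // x /= xD.
by exists (index x D) => //; rewrite nth_index.
Qed.

(** The generic maps are dense by the Baire argument. Each of their fibers lies in [G] plus at most
    [n] points, so every level is narrow and the dense set of levels can be the whole space. *)
Lemma P_l_sub_P_w n : P_l n K `<=` P_w n K.
Proof.
move=> d [->|[nd [G Gd Gf]]]; first by left.
case: d nd Gd => [d| |]//; last by left.
rewrite lee_fin -EFinB => nd Gd; right; split=> //.
exists setT; split; [exact: openT| |move=> f _ B /nbhs_contfunP[e e0 eB]].
  have [f _] := contfunP (@cst_continuous K 'rV[R]_n 0).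
  by exists f.
have [|g Sg fg] := comeager_dense f Gf (_ : 0 < e / 2); first by rewrite divr_gt0.
exists g; split; last first.
  by apply: eB => x; apply: le_lt_trans (fg x) _; lra.
exists setT => [|y _]; first by move=> O [x Ox] _; exists x.
apply: small_cover_dimH; first by rewrite subr_ge0.
move=> s c ds c0; have s0 : 0 < s by apply: le_lt_trans ds; rewrite subr_ge0.
apply: (@small_cover_sub _ _ _ c c (G `|` (g @^-1` [set y] `\` G))) => //.
  by move=> x gx; have [Gx|nGx] := pselect (G x); [left|right].
apply: small_cover_setU; first exact: ltW.
  apply: dimH_lt_small_cover => //; first by rewrite divr_gt0.
  by apply: le_lt_trans Gd _; rewrite lte_fin.
by apply: small_cover_card_le (Sg y) => //; rewrite divr_gt0.
Qed.

End P_l_P_w.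

(** * Level narrow maps *)

Section level_narrow_thin.
Context {R : realType} {K : metricType R}.
Implicit Types (O : set K).

Lemma open_forall_fin (T : finType) (A : T -> set K) : (forall t, open (A t)) ->
  open [set x | forall t, A t x].
Proof.
move=> oA; apply/open_mdistP => x Ax.
have [t r r' _ rr' H y xy|t|r r0 rA] := @fin_common_radius R T
  (fun t r => forall y, mdist x y < r -> A t y).
- by apply: H; exact: lt_le_trans xy rr'.
- by have /open_mdistP/(_ _ (Ax t)) := oA t.
by exists r => // y xy t; exact: rA.
Qed.

Lemma open_imply (P : Prop) (A : set K) : open A -> open [set x | P -> A x].
Proof.
move=> oA; have [p|np] := pselect P.
  by rewrite (_ : mkset _ = A)//; apply/seteqP; split=> x //= /(_ p).
rewrite (_ : mkset _ = setT); first exact: openT.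
by apply/seteqP; split=> // x _ /np.
Qed.

Lemma open_gt_fun (phi : K -> R) (a : R) : continuous phi ->
  open [set x | a < phi x].
Proof. by move=> /continuousP cphi; exact: (cphi _ (@open_gt _ a)). Qed.

Lemma open_lt_fun (phi : K -> R) (a : R) : continuous phi ->
  open [set x | phi x < a].
Proof. by move=> /continuousP cphi; exact: (cphi _ (@open_lt _ a)). Qed.

Lemma level_neighborhood n (f : contfun n K) (y : 'rV[R]_n) O :
  compact [set: K] -> open O -> f @^-1` [set y] `<=` O ->
  exists2 tau : R, 0 < tau & forall x, `|f x - y| < tau -> O x.
Proof.
move=> /compact_near_coveringP cK oO fO.
have [|tau /= tau0 tauP] := cK R (0^'+) (fun tau x => `|f x - y| < tau -> O x) _.
  move=> x _; have [fx|fx] := eqVneq (f x) y.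
    exists (O, setT) => [|[z e] [/= Oz _ _]//].
    by split; [apply: open_nbhs_nbhs; split=> //; exact: fO|exact: filterT].
  have r0 : 0 < `|f x - y| / 2 by rewrite divr_gt0// normr_gt0 subr_eq0.
  have /cvgrPdist_lt/(_ _ r0) fxz := @contfun_continuous _ _ _ f x.
  exists ([set z | `|f x - f z| < `|f x - y| / 2], [set e | e < `|f x - y| / 2]).
    by split=> //; exact: nbhs_right_lt.
  move=> [z e] /= [xz er] zy; exfalso.
  have := ler_normD (f x - f z) (f z - y); rewrite subrKA.
  by move: zy xz er; lra.
exists (tau / 2); first by rewrite divr_gt0.
move=> x; apply: (tauP (tau / 2)) => //=.
  by rewrite sub0r normrN ger0_norm ?divr_ge0 ?ltW// gtr_pMr// invf_lt1 ?ltr1n.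
by rewrite divr_gt0.
Qed.

Section shrink.
Variables (n : nat) (N : set (contfun n K)) (s c : R) (f0 : contfun n K).
Hypothesis cK : compact [set: K].
Hypothesis c0 : 0 < c.
Hypothesis N_dense : forall (g : contfun n K) (e : R), 0 < e ->
  (forall x, `|f0 x - g x| <= c) -> exists2 h, N h & forall x, `|g x - h x| < e.
Hypothesis N_narrow : forall h, N h -> exists2 S : set 'rV[R]_n, dense S &
  forall y e, S y -> 0 < e -> small_cover s e (h @^-1` [set y]).

(* The sets [U (t j)], [0 < j], carry bumps of height [c] that are added to the
   coordinates of [f0]; the levels of a narrow function [h] close to the result
   then serve as partitions meeting only in a fiber of [h]. *)
Lemma cover_shrink (I : finType) (U : I -> set K) (t : 'I_n.+1 -> I) (e : R) :
  0 < e -> injective t -> (forall i, open (U i)) -> (forall x, exists i, U i x) ->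
  (forall i x y, U i x -> U i y -> `|f0 x - f0 y| <= c / 8) ->
  exists (V : I -> set K) O, [/\ forall i, open (V i) /\ V i `<=` U i,
    forall x, exists i, V i x, open O, small_cover s e O &
    forall x, (forall j, V (t j) x) -> O x].
Proof.
move=> e0 tinj oU covU osc.
have [[p Up]|nU] := pselect (exists p, forall j, U (t j) p); last first.
  exists U, set0; split=> //; [by move=> i; split|exact: open0|
    exact: small_cover_set0 (ltW e0)|].
  by move=> x Ux; apply: nU; exists x.
have [|lam lam0 lamP] := @lebesgue_number _ _ _ U _ cK.
  by move=> x _; have [i Ui] := covU x; exists i; apply: open_nbhs_nbhs.
have lam_ge0 := ltW lam0.
pose u i := capdist lam (~` U i).
have u_gt0 i x : 0 < u i x -> U i x.
  by move=> ux; apply: contrapT => nUx; move: ux; rewrite /u capdist0// ltxx.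
have cu i : continuous (u i) by exact: capdist_continuous.
pose t' (j : 'I_n) := t (lift ord0 j).
have t't j : t' j <> t ord0 by move=> /tinj/eqP; rewrite eq_sym (negPf (neq_lift _ _)).
have t'inj j k : t' j = t' k -> j = k by move=> /tinj/lift_inj.
(* The bump is [c] where the [lam]-ball of [x] lies in [U (t' j)], and 0 outside [U (t' j)]. *)
pose b j x := c * (u (t' j) x / lam).
have [bmp bmpE] : exists g : contfun n K, forall x, g x = \row_j (f0 x ord0 j + b j x).
  apply: contfunP; apply: row_continuous => j x.
  apply: (@continuousD R R^o K (fun x => f0 x ord0 j) (b j)).
    exact: contfun_coord_continuous.
  apply: (@continuousM R K); first exact: cst_continuous.
  by apply: (@continuousM R K); [exact: cu|exact: cst_continuous].
have c80 : 0 < c / 8 by rewrite divr_gt0.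
have [|h Nh gh] := @N_dense bmp _ c80.
  move=> x; rewrite bmpE; apply/mx_norm_leP => [|j]; first exact: ltW.
  rewrite !mxE opprD addNKr normrN /b ger0_norm; last first.
    by rewrite mulr_ge0 ?divr_ge0 ?capdist_ge0// ltW.
  by rewrite ger_pMr// ler_pdivrMr// mul1r capdist_le_cap.
have hE x j : `|f0 x ord0 j + b j x - h x ord0 j| < c / 8.
  by have /(mx_norm_ltP _ c80)/(_ j) := gh x; rewrite bmpE !mxE.
have [S dS Sh] := N_narrow Nh.
(* [y] is taken near mid-height of the bumps above [f0 p]. Oscillation of [f0] and error of [h]
   being at most [c / 8], on [U (t' j)] the [j]-th coordinate of [h] is above that of [y] where the
   bump is full, and below it where the bump is less than [c / 8]. *)
have [y [yp Sy]] : (ball (\row_j (f0 p ord0 j + c / 2)) (c / 8)) `&` S !=set0.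
  apply: dS; last exact: ball_open.
  by exists (\row_j (f0 p ord0 j + c / 2)); exact: ballxx.
have yE j : `|f0 p ord0 j + c / 2 - y ord0 j| < c / 8.
  move: yp; rewrite -ball_normE /= => /(mx_norm_ltP _ c80)/(_ j).
  by rewrite !mxE.
have [ O [oO hO Os]] := small_cover_open (Sh y e Sy e0).
have [tau tau0 tauP] := level_neighborhood cK oO hO.
pose W j x := u (t' j) x < lam / 8 \/ h x ord0 j < y ord0 j + tau.
have hc j := @contfun_coord_continuous _ _ _ h j.
have oW j : open [set x | W j x].
  by apply: openU; [exact: open_lt_fun|exact: open_lt_fun].
(* A point cut from [U (t ord0)] violates some [W j]: its bump is positive and [h] is above the
   level, so [V (t' j)] keeps it. The cut in [U (t' j)] spares all points with full bump. Where all
   these members meet, [h] is within [tau] of [y]. *)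
pose V i := [set x | U i x /\ (i = t ord0 -> forall j, W j x) /\
  forall j, i = t' j -> y ord0 j - tau < h x ord0 j].
have oscp j x : U (t' j) x -> `|f0 p ord0 j - f0 x ord0 j| <= c / 8.
  move=> Ux; have /(mx_norm_leP _ (ltW c80))/(_ j) := osc _ _ _ (Up _) Ux.
  by rewrite !mxE.
exists V, O; split=> //.
- move=> i; split; last by move=> x [].
  apply: openI => //; apply: openI; first by apply: open_imply; exact: open_forall_fin.
  by apply: open_forall_fin => j; apply: open_imply; exact: open_gt_fun.
- move=> x; have [i Ui] := lamP x Logic.I.
  have Uix : U i x by apply: Ui; rewrite mdistxx.
  have [it|nit] := pselect (i = t ord0).
    have [Wx|] := pselect (forall j, W j x).
      by exists i; split=> //; split=> // j; rewrite it => /esym/t't.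
    move=> /existsNP[j] /not_orP[/negP + /negP]; rewrite -!leNgt => lu yh.
    exists (t' j); split; first by apply: u_gt0; apply: lt_le_trans lu; rewrite divr_gt0.
    by split=> [/t't//|k /t'inj <-]; lra.
  exists i; split=> //; split=> // j ij; rewrite ij in Ui Uix.
  have bj : b j x = c.
    rewrite /b /u capdistT ?divff ?mulr1 ?gt_eqF// => a Ua.
    by rewrite leNgt; apply/negP => /Ui.
  have := oscp j x Uix; have := hE x j; have := yE j; rewrite bj !ltr_norml ler_norml.
  by move=> /andP[? ?] /andP[? ?] /andP[? ?]; lra.
move=> x Vx; apply: tauP; apply/mx_norm_ltP => // j; rewrite !mxE ltr_norml.
have [Ux [_ /(_ j erefl) hy]] := Vx (lift ord0 j).
have [_ [/(_ erefl j) Wj _]] := Vx ord0.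
apply/andP; split; first by lra.
case: Wj => [ux|]; last by lra.
have bx : b j x < c / 8.
  by rewrite /b ltr_pM2l// ltr_pdivrMr// mulrC.
have := oscp j x Ux; have := hE x j; have := yE j; rewrite !ltr_norml ler_norml.
by move=> /andP[? ?] /andP[? ?] /andP[? ?]; lra.
Qed.

Lemma cover_shrink_seq (I : finType) (U : I -> set K)
    (l : seq {ffun 'I_n.+1 -> I}) (e : R) : 0 < e ->
  (forall t, t \in l -> injective t) ->
  (forall i, open (U i)) -> (forall x, exists i, U i x) ->
  (forall i x y, U i x -> U i y -> `|f0 x - f0 y| <= c / 8) ->
  exists (V : I -> set K) O, [/\ forall i, open (V i) /\ V i `<=` U i,
    forall x, exists i, V i x, open O, small_cover s e O &
    forall t x, t \in l -> (forall j, V (t j) x) -> O x].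
Proof.
elim: l U e => [|t l IH] U e e0 linj oU covU osc.
  by exists U, set0; split=> //; [move=> i; split|exact: open0|
    exact: small_cover_set0 (ltW e0)].
have e40 : 0 < e / 4 by rewrite divr_gt0.
have [|V1 [ O1 [V1U covV1 oO1 O1s V1O]]] := cover_shrink e40 _ oU covU osc (t := t).
  by apply: linj; rewrite mem_head.
have [|||V [ O2 [VV1 covV oO2 O2s VO]]] := IH V1 _ e40 _ _ covV1.
- by move=> t' t'l; apply: linj; rewrite inE t'l orbT.
- by move=> i; have [] := V1U i.
- by move=> i x y /(V1U i).2 Ux /(V1U i).2 Uy; exact: osc Ux Uy.
exists V, (O1 `|` O2); split=> //.
- move=> i; split; first exact: (VV1 i).1.
  exact: subset_trans (VV1 i).2 (V1U i).2.
- exact: openU.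
- by apply: small_cover_setU => //; exact: ltW.
move=> t' x; rewrite inE => /predU1P[->|t'l] Vx; last by right; exact: VO Vx.
by left; apply: V1O => j; exact: (VV1 _).2.
Qed.

Lemma shrink_thin : (0 < n)%N -> thin n s [set: K].
Proof.
move=> n0 e e0.
have c80 : 0 < c / 8 by rewrite divr_gt0.
have [d d0 fd] := contfun_unif f0 cK c80.
pose r := Num.min d e / 2.
have r0 : 0 < r by rewrite divr_gt0// lt_min d0.
have [||D KD] := compact_finite_cover cK (V := fun x => thicken r [set x]).
- by move=> x; exact: thicken_open.
- by move=> x _; exists x => //; exact: sub_thicken.
pose U (a : D) := thicken r [set fsval a].
have Ud i x y : U i x -> U i y -> mdist x y < Num.min d e.
  move=> [_ -> ix] [_ -> iy]; have := metric_triangle x (fsval i) y.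
  by rewrite (metric_sym x (fsval i)) [ltRHS]splitr; move: ix iy; rewrite -/r; lra.
(* Shrinking along all injective tuples gives a cover of order [n] off [O]: a point in [n + 1]
   distinct members lies in [O]. *)
have [||||V [ O [VU covV oO Os VO]]] := @cover_shrink_seq D U
    [seq t : {ffun 'I_n.+1 -> D} <- enum {ffun 'I_n.+1 -> D} | injectiveb t] e e0.
- by move=> t; rewrite mem_filter => /andP[/injectiveP].
- by move=> i; exact: thicken_open.
- by move=> x; have [a aD ax] := KD x Logic.I; exists [` aD]%fset.
- move=> i x y /Ud H /H; rewrite lt_min => /andP[xy _]; exact/ltW/fd.
have [|lam lam0 lamP] := @lebesgue_number _ _ _ V _ cK.
  move=> x _; have [i Vi] := covV x; exists i; apply: open_nbhs_nbhs.
  by split=> //; have [] := VU i.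
have lam_ge0 := ltW lam0.
pose u i := capdist lam (~` V i).
have u_gt0 i x : 0 < u i x -> V i x.
  by move=> ux; apply: contrapT => nVx; move: ux; rewrite /u capdist0// ltxx.
have uT x : exists i, u i x = lam.
  have [i Vi] := lamP x Logic.I; exists i; apply: capdistT => // a Va.
  by rewrite leNgt; apply/negP => /Vi.
(* [[0, lam]] is cut into [n] intervals of length [h]; [A k] below gathers the points for which no
   [u i] takes a value inside the [k]-th one. *)
pose h := lam / n%:R.
have n0' : (0 : R) < n%:R by rewrite ltr0n.
have h0 : 0 < h by rewrite divr_gt0.
have hn k : (k < n)%N -> h * k.+1%:R <= lam.
  by move=> kn; rewrite -[leRHS](divfK (lt0r_neq0 n0')) ler_wpM2l ?(ltW h0)// ler_nat.
have hS k : h * k.+1%:R = h * k%:R + h by rewrite -natr1 mulrDr mulr1.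
have hk0 k : 0 <= h * k%:R by rewrite mulr_ge0// ltW.
pose A k := [set x | forall i, ~ (h * k%:R < u i x < h * k.+1%:R)].
exists h, A, O; split=> //.
  (* The [u i] are 1-Lipschitz, so on [A k] crossing the interval takes a distance of at least [h].
     Each label contains an index where [u i] is [lam], so points with equal labels share a member
     of the cover. *)
  move=> k kn; exists {ffun D -> bool}, (fun x => [ffun i => h * k.+1%:R <= u i x]).
  move=> x y Ax Ay; split=> [lxy|xy].
    have [i uix] := uT x; have := congr1 (fun l : {ffun D -> bool} => l i) lxy.
    rewrite !ffunE uix hn// => /esym uiy.
    have Ux : U i x by apply: (VU i).2; apply: u_gt0; rewrite uix.
    have Uy : U i y.
      apply: (VU i).2; apply: u_gt0; apply: lt_le_trans uiy.
      by rewrite mulr_gt0// ltr0n.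
    by have := Ud _ _ _ Ux Uy; rewrite lt_min => /andP[_ /ltW].
  apply/ffunP => i; rewrite !ffunE.
  have := capdist_lip (~` V i) lam_ge0 x y; rewrite -/(u i) ler_norml => /andP[? ?].
  apply/idP/idP => H; rewrite leNgt; apply/negP => H'.
    by apply: (Ay i); apply/andP; split=> //; have := hS k; lra.
  by apply: (Ax i); apply/andP; split=> //; have := hS k; lra.
move=> x _; have [[k Ak]|nA] := pselect (exists k : 'I_n, A k x).
  by left; exists k.
(* If every interval contains a value, the [n] indices found and one with value [lam] are [n + 1]
   distinct members containing [x]. *)
right; have /choice[i iP] : forall k : 'I_n, exists i, h * k%:R < u i x < h * k.+1%:R.
  move=> k; apply: contrapT => H; apply: nA; exists k => i hi; apply: H.
  by exists i.
have [i0 i0x] := uT x.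
pose t : {ffun 'I_n.+1 -> D} := [ffun j => if unlift ord0 j is Some k then i k else i0].
apply: (VO t x).
  rewrite mem_filter mem_enum inE andbT; apply/injectiveP => j k; rewrite !ffunE.
  have ii0 l : i l <> i0.
    by move=> il; have := iP l; rewrite il i0x; have := hn _ (ltn_ord l); lra.
  have mono (a b : 'I_n) : i a = i b -> (b <= a)%N.
    move=> iab; rewrite leqNgt; apply/negP => ab.
    have := iP a; have := iP b; rewrite iab.
    have : h * a.+1%:R <= h * b%:R by rewrite ler_wpM2l ?(ltW h0)// ler_nat.
    lra.
  case: unliftP => [a ->|->]; case: unliftP => [b ->|->] //.
  - by move=> iab; congr lift; apply: val_inj; apply/eqP;
      rewrite eqn_leq !mono.
  - by move=> /ii0.
  - by move=> /esym/ii0.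
move=> j; apply: u_gt0; rewrite !ffunE; case: unliftP => [k _|_]; last by rewrite i0x.
by have /andP[] := iP k; have := hk0 k; lra.
Qed.

End shrink.

Lemma level_narrow_thin n (d s : R) : (0 < n)%N -> compact [set: K] -> 0 < s ->
  d - n%:R < s -> somewhere_dense (@level_narrow R n K d%:E) -> thin n s [set: K].
Proof.
move=> n0 cK s0 ds [Q [oQ [f0 Qf0] QN]].
have /nbhs_contfunP[r r0 rQ] : nbhs f0 Q by exact: open_nbhs_nbhs.
apply: (@shrink_thin n (@level_narrow R n K d%:E) s (r / 2) f0) => //.
- by rewrite divr_gt0.
- move=> g e e0 fg; have /QN : Q g.
    by apply: rQ => x; apply: le_lt_trans (fg x) _; lra.
  move=> /(_ [set h | forall x, `|g x - h x| < e]).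
  by case=> [|h [Nh gh]]; [apply/nbhs_contfunP; exists e|exists h].
move=> h [S dS Sh]; exists S => // y e Sy e0.
apply: dimH_lt_small_cover => //; apply: le_lt_trans (Sh _ Sy) _.
by rewrite -EFinB lte_fin.
Qed.

End level_narrow_thin.

(** * Membership in [P_l] and lower bound for [P_w] *)

Local Open Scope ereal_scope.

Theorem theorem6p6 (R : realType) (K : metricType R) (n : nat) :
  (0 < n)%N -> compact [set: K] -> n%:R%:E <= dimt [set: K] ->
  is_min (P_l n K) (dimtH n [set: K]) /\ is_min (P_w n K) (dimtH n [set: K]).
Proof.
move=> n0 cK nK.
have nD : n%:R%:E <= dimtH n [set: K].
  rewrite leNgt; apply/negP => /dimtH_lt_dimt_lt/dimt_ltE/(le_trans nK).
  by rewrite lee_fin; lra.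
have PlD : P_l n K (dimtH n [set: K]).
  case D : (dimtH n [set: K]) nD => [r| |]//; last by left.
  rewrite lee_fin => nr; right; split; first by rewrite lee_fin.
  have [||G Gr Gf] := @thin_generic _ K n (r - n%:R)%R cK.
  - by rewrite subr_ge0.
  - move=> s rs; apply: dimtH_thin => //; first by lra.
    by rewrite D lte_fin; lra.
  by exists G => //; rewrite -EFinB.
have lbD : lbound (P_w n K) (dimtH n [set: K]).
  move=> d [->|[nd Nd]]; first exact: leey.
  case: d nd Nd => [d| |]//; last by move=> _ _; exact: leey.
  (* The margin [e] is there because thinness is obtained only for positive [s] strictly above
     [d - n]. *)
  rewrite lee_fin => nd Nd; apply/lee_addgt0Pr => e e0.
  have -> : d%:E + e%:E = (d - n%:R + e + n%:R)%:E.
    by rewrite -EFinD; congr EFin; ring.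
  apply: thin_dimtH; first by lra.
  by apply: level_narrow_thin Nd => //; lra.
(* Since [P_l] is contained in [P_w], the lower bound passes to [P_l] and membership passes to
   [P_w]. *)
split; split=> //; first by move=> d /P_l_sub_P_w; exact: lbD.
exact: P_l_sub_P_w.
Qed.
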